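(* Let $G$ be a finitely generated amenable group with a finite symmetric set of generators $P$, and let $p\in\ell^1(G)$ satisfy $0\le p(x)\le 1$ and $p(x)=p(x^{-1})$ for all $x\in G$. Let $(\Omega,\mathcal A,\mathbb P)$ be the associated long-range percolation probability space, and let $(Q_n)_{n\in\mathbb N}$ be a strictly increasing, tempered Følner sequence in $G$ such that each $Q_n$ is a monotile of $G$. Then for $\mathbb P$-almost every $\omega\in\Omega$ the two limits $$N:=\lim_{j\to\infty}\frac{F_\omega(Q_j)}{|Q_j|}=\lim_{n\to\infty}\sum_{S\in\mathcal S(Q_n)}\nu_S\,\frac{\tilde F(S)}{|Q_n|}$$ exist in the Banach space $\mathcal B(\mathbb R)$ (i.e. with respect to the supremum norm) and are equal.
   Context: Metric. $\mathbb N=\{1,2,\dots\}$. For $g,h\in G$, $d(g,h)$ is the least $L\in\mathbb N_0$ such that $gh^{-1}$ is a product of $L$ elements of $P$ (the empty product being the identity). Sequences of sets. A Følner sequence is a sequence $(Q_n)$ of nonempty finite subsets of $G$ with $\lim_{n\to\infty}|KQ_n\setminus Q_n|/|Q_n|=0$ for every finite $K\subset G$. It is tempered if there is $C>0$ with $|\bigcup_{k<n}Q_k^{-1}Q_n|\le C|Q_n|$ for all $n$, and strictly increasing if $|Q_{n+1}|>|Q_n|$ for all $n$. A finite set $Q\subset G$ is a monotile of $G$ if there is $T\subset G$ such that $G$ is the disjoint union of the sets $Qt$, $t\in T$. Percolation. Let $E$ be the edge set of the complete undirected graph $\Gamma$ with vertex set $G$; an edge is an unordered pair $[x,y]$ of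 distinct elements of $G$. Set $\Omega=\{0,1\}^E$, $\mathcal A$ the $\sigma$-algebra generated by cylinder sets, and $\mathbb P=\prod_{e\in E}\mathbb P_e$ the product measure with $\mathbb P_e(\omega(e)=1)=p(xy^{-1})$ and $\mathbb P_e(\omega(e)=0)=1-p(xy^{-1})$ for $e=[x,y]$. For $\omega\in\Omega$ let $E_\omega=\{e\in E:\omega(e)=1\}$, $\Gamma_\omega=(G,E_\omega)$, and $m_\omega(x)=|\{y\in G:[x,y]\in E_\omega\}|$. For almost every $\omega$, $m_\omega(x)<\infty$ for all $x\in G$; only such $\omega$ are considered. Operators. For finite $Q\subset G$, $\Delta_\omega[Q]$ is the restriction to $\ell^2(Q)$ of the Laplacian of $\Gamma_\omega$, i.e. the symmetric matrix indexed by $Q$ with diagonal entries $m_\omega(x)$ (degree in the whole graph $\Gamma_\omega$), entry $-1$ at $(x,y)$ if $[x,y]\in E_\omega$, and $0$ otherwise. For a finite subgraph $S=(V_S,E_S)$ of $\Gamma$, $\Delta_S$ on $\ell^2(V_S)$ is $\Delta_Sf(x)=\sum_{y\in V_S:[x,y]\in E_S}(f(x)-f(y))$. $\mathcal S$ denotes the set of finite subgraphs of $\Gamma$ and $\mathcal S(Q)$ those with vertex set $Q$. Counting functions. $\mathcal B(\mathbb R)$ is the Banach space of bounded right-continuous functions $\mathbb R\to\mathbb R$ with the supremum norm. For a selfadjoint operator $A$ on a finite dimensional Hilbert space, $n(A)\in\mathcal B(\mathbb R)$ is given by: $n(A)(E)$ is the number of eigenvalues of $A$, counted with multiplicity, that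 are $\le E$. Set $F_\omega(Q)=n(\Delta_\omega[Q])$ and $\tilde F(S)=n(\Delta_S)$. Frequencies. For $S=(V_S,E_S)\in\mathcal S$, $$\nu_S=\prod_{[x,y]\in E_S}p(xy^{-1})\cdot\prod_{[x,y]\in E\setminus E_S,\;x,y\in V_S}(1-p(xy^{-1})),$$ which is the almost sure value of $\lim_j |\{x\in G: V_Sx\subset Q_j,\ \Gamma_\omega[V_Sx]=Sx\}|/|Q_j|$, where $\Gamma_\omega[\cdot]$ is the induced subgraph and $Sx$ the right translate of $S$ by $x$. The function $N$ is called the integrated density of states. *)

(* Defs.v *)
From HB Require Import structures.
From mathcomp Require Import all_boot all_order all_algebra finmap.
From mathcomp Require Import all_classical all_reals all_analysis.

Set Implicit Arguments.
Unset Strict Implicit.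
Unset Printing Implicit Defensive.
Import Order.TTheory GRing.Theory Num.Theory.
Import numFieldNormedType.Exports.

Local Open Scope classical_set_scope.
Local Open Scope ring_scope.

Definition symmetric_set (G : groupType) (P : {fset G}) : Prop :=
  forall x : G, x \in P -> (x^-1)%g \in P.

Definition generates (G : groupType) (P : {fset G}) : Prop :=
  forall g : G, exists2 s : seq G, {subset s <= P} & g = (\prod_(x <- s) x)%g.

Definition folner (R : realType) (G : groupType) (Q : nat -> {fset G}) : Prop :=
  (forall n, Q n != fset0%fset) /\
  (forall K : {fset G},
    (fun n => #|` [fset (k * q)%g | k in K, q in Q n] `\` Q n|%fset%:R
              / #|` Q n|%:R : R) @ \oo --> (0 : R)).

Definition amenable (R : realType) (G : groupType) : Prop :=
  exists Q : nat -> {fset G}, folner R Q.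

Definition tempered (R : realType) (G : groupType) (Q : nat -> {fset G}) : Prop :=
  exists2 C : R, 0 < C & forall n : nat,
    #|` \bigcup_(k <- iota 0 n) [fset (x^-1 * y)%g | x in Q k, y in Q n]|%fset%:R
    <= C * #|` Q n|%:R.

Definition strictly_increasing (G : groupType) (Q : nat -> {fset G}) : Prop :=
  forall n : nat, (#|` Q n| < #|` Q n.+1|)%N.

Definition monotile (G : groupType) (Q : {fset G}) : Prop :=
  exists T : set G,
    let Qt (t : G) := [set (q * t)%g | q in [set` Q]] in
    \bigcup_(t in T) Qt t = [set: G] /\ trivIset T Qt.

(* The unordered pair [x, y] is the two-element set [fset x; y]. *)
Definition edge (G : groupType) := {e : {fset G} | #|` e| == 2%N}.

Definition adj (G : groupType) (A : pred (edge G)) (x y : G) : bool :=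
  if insub [fset x; y]%fset is Some e then A e else false.

(* For e = [x, y] this is p (x y^-1); the order in which the two endpoints are
   listed is irrelevant when p is symmetric, see edge_probE. *)
Definition edge_prob (R : realType) (G : groupType) (p : G -> R) (e : edge G) : R :=
  p (nth 1%g (val e) 0%N * (nth 1%g (val e) 1%N)^-1)%g.

Lemma edge_probE (R : realType) (G : groupType) (p : G -> R) (e : edge G)
    (x y : G) :
  (forall z, p z = p (z^-1)%g) -> val e = [fset x; y]%fset ->
  edge_prob p e = p (x * y^-1)%g.
Proof.
move=> psym exy; rewrite /edge_prob exy.
have /eqP := valP e; rewrite exy cardfs2 => -[].
case: eqVneq => //= xy _.
have : perm_eq (enum_fset [fset x; y]%fset) [:: x; y].
  apply: uniq_perm; rewrite ?fset_uniq //= ?inE ?xy // => z.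
  by have := in_fset2 z x y; rewrite !inE.
have : size (enum_fset [fset x; y]%fset) = 2 by have := cardfs2 x y; rewrite xy.
case: (enum_fset _) => [|a [|b []]] //= _ abxy.
have ain : a \in [:: x; y] by rewrite -(perm_mem abxy) mem_head.
have bin : b \in [:: x; y] by rewrite -(perm_mem abxy) !inE eqxx orbT.
have : uniq [:: a; b] by rewrite (perm_uniq abxy) /= inE xy.
move: ain bin; rewrite /= !inE => /orP[]/eqP-> /orP[]/eqP->; rewrite ?eqxx //.
by move=> _; rewrite psym invgM invgK.
Qed.

Definition cylinder (G : groupType) (A : {fset edge G}) (c : edge G -> bool) :
    set (edge G -> bool) :=
  [set w | forall e, e \in A -> w e = c e].

Definition cylinders (G : groupType) : set (set (edge G -> bool)) :=
  [set C | exists A c, C = cylinder A c].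

Notation config G := (g_sigma_algebraType (@cylinders G)).

(* The product measure is characterised by its values on cylinder sets, which
   form a pi-system generating the sigma-algebra. *)
Definition percolation_measure (R : realType) (G : groupType) (p : G -> R)
    (mu : probability (config G) R) : Prop :=
  forall (A : {fset edge G}) (c : edge G -> bool),
    mu (cylinder A c) =
    (\prod_(e <- A) (if c e then edge_prob p e else 1 - edge_prob p e))%:E.

(* fset_set sends infinite sets to fset0, so the degree takes the junk value 0
   at vertices of infinite degree; almost surely there are none. *)
Definition degree (G : groupType) (w : config G) (x : G) : nat :=
  #|` fset_set [set y : G | adj w x y]|.

(* Matrices indexed by a finite set Q are indexed by the positions in the
   enumeration of Q. *)
Definition vtx (G : groupType) (Q : {fset G}) (i : 'I_#|` Q|) : G := nth 1%g Q i.

Definition laplacian_restr (R : realType) (G : groupType) (w : config G)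
    (Q : {fset G}) : 'M[R]_#|` Q| :=
  \matrix_(i, j)
    if i == j then (degree w (vtx i))%:R
    else if adj w (vtx i) (vtx j) then -1 else 0.

Definition subgraph (G : groupType) :=
  {S : {fset G} * {fset edge G} | all (fun e => val e `<=` S.1)%fset S.2}.

Definition vertices (G : groupType) (S : subgraph G) : {fset G} := (val S).1.
Definition edges (G : groupType) (S : subgraph G) : {fset edge G} := (val S).2.

Definition subgraphs_on (G : groupType) (Q : {fset G}) : set (subgraph G) :=
  [set S | vertices S = Q].

Definition laplacian_op (R : realType) (G : groupType) (S : subgraph G)
    (f : 'rV[R]_#|` vertices S|) : 'rV[R]_#|` vertices S| :=
  \row_i \sum_(j | adj (mem (edges S)) (vtx i) (vtx j)) (f 0 i - f 0 j).

Definition laplacian (R : realType) (G : groupType) (S : subgraph G) :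
    'M[R]_#|` vertices S| :=
  lin1_mx (@laplacian_op R G S).

(* The number of eigenvalues of A that are at most E, with multiplicity.  Used
   for symmetric A only, for which the multiplicity of an eigenvalue is the
   dimension of its eigenspace. *)
Definition eigen_count (R : realType) (n : nat) (A : 'M[R]_n) (E : R) : nat :=
  (\big[addn/0]_(a \in [set a : R | eigenvalue A a /\ (a <= E)%R])
    \rank (eigenspace A a))%N.

Definition F_count (R : realType) (G : groupType) (w : config G) (Q : {fset G})
    (E : R) : nat :=
  eigen_count (laplacian_restr R w Q) E.

Definition Ftilde_count (R : realType) (G : groupType) (S : subgraph G)
    (E : R) : nat :=
  eigen_count (laplacian R S) E.

Definition nu (R : realType) (G : groupType) (p : G -> R) (S : subgraph G) : R :=
  \prod_(e <- edges S) edge_prob p e *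
  \big[*%R/1]_(e \in [set e : edge G | (val e `<=` vertices S)%fset /\ e \notin edges S])
    (1 - edge_prob p e).

Definition BR (R : realType) : set (R -> R) :=
  [set f | bounded_fun f /\ right_continuous f].

Definition supnorm (R : realType) (f : R -> R) : R :=
  sup (range (fun x => `|f x|)).

Definition cvg_BR (R : realType) (u : nat -> R -> R) (N : R -> R) : Prop :=
  [/\ forall n, BR (u n), BR N &
      (fun n => supnorm (u n \- N)) @ \oo --> (0 : R)].

(* Main.v *)
Require Import Defs.
From mathcomp Require Import all_boot all_order all_algebra finmap.
From mathcomp Require Import all_classical all_reals all_analysis.
From mathcomp Require complex.
From mathcomp Require Import measurable_realfun zify ring lra.

(** Fix a tile Q = Q_M and a set T of translations such that the Q t, t in T,
    partition G.  For large j the Folner set D = Q_j is, up to o(|D|) points, the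
    union of the tiles Q t lying inside it (inner_tiles_card).  Cut D along
    these tiles.  Call a vertex of an inner tile escaping when an open edge
    leads out of its tile.  At a non-escaping vertex the row of the Laplacian
    of D agrees with the row of the Laplacian of the finite graph seen inside
    the tile, so the two operators differ only on the escaping vertices and on
    the points of D outside the inner tiles.  By the variational description of
    the eigenvalue count of a symmetric matrix, such a change moves the count by
    at most the number of those points, uniformly in the energy
    (eigen_count_tiles, F_count_tiles).

    The randomness enters in two ways, and both are controlled by exponential
    moments of sums of independent indicators (indep_chernoff).

    - Different tiles see disjoint sets of edges, so the patterns seen in the
      tiles are independent and identically distributed, a pattern S having
      probability nu_S.  The number of inner tiles with pattern S is within
      d |D| of its mean except with probability at most 2 exp (- d^2 |D| / 8)
      (frequency_event).
    - The number of escaping vertices is at most twice the number of open edges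
      that leave the inner tiles.  Their expected number is at most a |D|, where
      a |Q| bounds the mass of p carried by the pairs (q, g) with q in Q and
      g q outside Q.  For Q = Q_M this ratio a tends to 0 when M grows, because
      p is summable and (Q_n) is Folner (folner_boundary_mass).  Hence more than
      8 a |D| vertices escape with probability at most exp (- a |D|)
      (escaping_event).

    Since the sizes |Q_j| strictly increase they are at least j, so all these
    probabilities are summable in j, and the Borel-Cantelli lemma turns them into
    almost sure statements (ae_of_events).  Altogether, almost surely and
    uniformly in the energy, F_w(Q_j) / |Q_j| stays eventually within 10 a of the
    deterministic average A_M = sum_S nu_S Ftilde(S) / |Q_M| (ae_count_estimate).

    This last statement gives everything at once: evaluated at a single good
    configuration it shows that (A_M) is uniformly Cauchy, its limit N does not
    depend on the configuration, and F_w(Q_j) / |Q_j| converges to the same N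
    for almost every w (uniform_limit_of_approximants). *)

Set Implicit Arguments.
Unset Strict Implicit.
Unset Printing Implicit Defensive.
Import Order.TTheory GRing.Theory Num.Theory.
Import numFieldNormedType.Exports.

Local Open Scope classical_set_scope.
Local Open Scope ring_scope.

(** * Real symmetric matrices *)

Section SymmetricSpectrum.
Import complex.

(** Over the complex numbers the matrix is Hermitian, hence unitarily
    diagonalizable with a real spectrum; so its minimal polynomial, which is
    the same over the reals, is a product of distinct real linear factors. *)
Lemma symmetric_diagonalizable (R : rcfType) n (A : 'M[R]_n) :
  A^T = A -> diagonalizable A.
Proof.
case: n A => [|n] A symA; first by rewrite (flatmx0 A); apply: diagonalizable0.
pose toC := real_complex R; pose B := map_mx toC A.
have toC_real x : toC x \is Num.real.
  by apply/complex_realP; exists x.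
have hermB : B \is hermsymmx.
  apply: realsym_hermsym.
    by apply/is_hermitianmxP; rewrite expr0 scale1r map_mx_id // map_trmx symA.
  by apply/mxOverP => i j; rewrite mxE; exact: toC_real.
have /orthomx_spectralP BE := hermitian_normalmx hermB.
have dreal := hermitian_spectral_diag_real hermB.
apply/diagonalizableP.
set d := spectral_diag B in BE dreal.
pose rs := undup [seq complex.Re (d 0 i) | i <- enum 'I_n.+1].
exists rs; first exact: undup_uniq.
have dE i : d 0 i = toC (complex.Re (d 0 i)).
  have /mxOverP/(_ 0 i)/complex_realP[x ->] := dreal.
  by [].
rewrite -(dvdp_map toC) -mxminpoly_map -/B BE.
rewrite -(conjVmx _ (spectral_unit B)) mxminpoly_uconj ?unitmx_inv ?spectral_unit //.
rewrite mxminpoly_diag (_ : map (d 0) _ = map toC [seq complex.Re (d 0 i) | i <- enum 'I_n.+1]).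
  rewrite undup_map_inj ?big_map; last exact: fmorph_inj.
  rewrite rmorph_prod /=.
  under [X in _ %| X]eq_bigr => r _ do rewrite rmorphB /= map_polyX map_polyC.
  by [].
rewrite -[RHS]map_comp; apply: eq_map => i; exact: dE.
Qed.

End SymmetricSpectrum.

Lemma symmetric_spectrum (R : rcfType) n (A : 'M[R]_n) : A^T = A ->
  exists k (e : 'I_k -> R), injective e /\
    (\sum_i eigenspace A (e i) :=: 1%:M)%MS.
Proof.
move=> /symmetric_diagonalizable/diagonalizablePeigen[rs urs].
rewrite (big_nth 0) big_mkord => rsP; exists (size rs), (fun i => rs`_i).
by split=> // i j /eqP; rewrite nth_uniq // => /eqP/val_inj.
Qed.

Definition dotv (R : comNzRingType) n (v w : 'rV[R]_n) : R := (v *m w^T) 0 0.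

Definition qform (R : comNzRingType) n (A : 'M[R]_n) (v : 'rV[R]_n) : R :=
  dotv (v *m A) v.

Lemma dotvE (R : comNzRingType) n (v w : 'rV[R]_n) :
  dotv v w = \sum_i v 0 i * w 0 i.
Proof. by rewrite /dotv mxE; apply: eq_bigr => i _; rewrite mxE. Qed.

Lemma dotv_ge0 (R : realDomainType) n (v : 'rV[R]_n) : 0 <= dotv v v.
Proof. by rewrite dotvE sumr_ge0 // => i _; rewrite -expr2 sqr_ge0. Qed.

Lemma dotv_gt0 (R : realDomainType) n (v : 'rV[R]_n) : v != 0 -> 0 < dotv v v.
Proof.
move=> v0; rewrite lt_neqAle dotv_ge0 andbT eq_sym; apply: contra v0 => /eqP v0.
apply/eqP/rowP => i; rewrite !mxE; apply/eqP; rewrite -sqrf_eq0 expr2.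
move: v0; rewrite dotvE => /eqP; rewrite psumr_eq0 => [/allP/(_ i)|j _].
  by apply; rewrite mem_index_enum.
by rewrite -expr2 sqr_ge0.
Qed.

Lemma dotv_suml (R : comNzRingType) n (I : Type) (r : seq I) (P : pred I)
    (u : I -> 'rV[R]_n) w :
  dotv (\sum_(i <- r | P i) u i) w = \sum_(i <- r | P i) dotv (u i) w.
Proof. by rewrite /dotv mulmx_suml summxE. Qed.

Lemma dotv_sumr (R : comNzRingType) n (I : Type) (r : seq I) (P : pred I)
    (u : I -> 'rV[R]_n) w :
  dotv w (\sum_(i <- r | P i) u i) = \sum_(i <- r | P i) dotv w (u i).
Proof. by rewrite /dotv raddf_sum mulmx_sumr summxE. Qed.

Lemma eigenspace_orth (R : idomainType) n (A : 'M[R]_n) a b (v w : 'rV[R]_n) :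
  A^T = A -> a != b -> v *m A = a *: v -> w *m A = b *: w -> dotv v w = 0.
Proof.
move=> symA ab vA wA; apply/eqP; move: ab; rewrite -subr_eq0 => ab.
rewrite -(mulrI_eq0 _ (lregP ab)) mulrBl subr_eq0; apply/eqP.
rewrite /dotv; transitivity ((v *m A *m w^T) 0 0).
  by rewrite vA -scalemxAl [RHS]mxE.
by rewrite -mulmxA -{1}symA -trmx_mul wA linearZ -scalemxAr [LHS]mxE.
Qed.

Lemma eigen_countE (R : realType) n (A : 'M[R]_n) k (e : 'I_k -> R) (E : R) :
  A^T = A -> injective e -> (\sum_i eigenspace A (e i) :=: 1%:M)%MS ->
  eigen_count A E = (\sum_(i | (e i <= E)%R) \rank (eigenspace A (e i)))%N.
Proof.
move=> symA inj_e eP.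
have eigen_e a : eigenvalue A a -> exists i, a = e i.
  move=> /eigenvalueP[v vA v0]; apply: contrapT => eNa.
  have : (v <= \sum_i eigenspace A (e i))%MS by rewrite eP submx1.
  move=> /sub_sumsmxP[u vE]; have := dotv_gt0 v0.
  rewrite {2}vE dotv_sumr big1 ?ltxx // => i _.
  apply: (@eigenspace_orth _ _ A a (e i)) => //.
    by apply/eqP => aE; apply: eNa; exists i.
  by apply/eigenspaceP; rewrite submxMl.
rewrite /eigen_count (fsbig_fwiden [seq e i | i <- enum 'I_k & e i <= E]).
- by rewrite big_map big_filter big_enum_cond.
- move=> a [/eigen_e[i ->] eE] /=; apply/mapP; exists i => //.
  by rewrite mem_filter mem_enum andbT.
- by rewrite map_inj_uniq // filter_uniq // enum_uniq.
move=> a [/= /mapP[i]]; rewrite mem_filter => /andP[eE _] -> nP.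
apply/eqP; rewrite mxrank_eq0; apply: contra_notT nP => ai.
by split.
Qed.

(** V and W are the spectral subspaces for the eigenvalues at most E and larger
    than E.  Everything about the eigenvalue count is derived from the sign of
    the quadratic form A - E on these two complementary spaces. *)
Lemma spectral_split (R : realType) n (A : 'M[R]_n) (E : R) : A^T = A ->
  exists V W : 'M[R]_n,
  [/\ \rank V = eigen_count A E, (\rank V + \rank W = n)%N,
      forall v : 'rV_n, (v <= V)%MS -> qform A v <= E * dotv v v &
      forall v : 'rV_n, (v <= W)%MS -> v != 0 -> E * dotv v v < qform A v].
Proof.
move=> symA; have [k [e [inj_e eP]]] := symmetric_spectrum symA.
pose S (P : pred 'I_k) := (\sum_(i | P i) eigenspace A (e i))%MS.
have rankS P : \rank (S P) = (\sum_(i | P i) \rank (eigenspace A (e i)))%N.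
  by apply/mxdirectP/mxdirect_sum_eigenspace => i j _ _ /inj_e.
have formS P v : (v <= S P)%MS -> exists2 d : 'I_k -> R,
    forall i, 0 <= d i & qform A v - E * dotv v v = \sum_(i | P i) (e i - E) * d i
      /\ dotv v v = \sum_(i | P i) d i.
  move=> /sub_sumsmxP[u ->]; set w := fun i => u i *m eigenspace A (e i).
  have wA i : w i *m A = e i *: w i by apply/eigenspaceP; rewrite submxMl.
  have dotE (c : 'I_k -> R) : dotv (\sum_(i | P i) c i *: w i) (\sum_(i | P i) w i)
      = \sum_(i | P i) c i * dotv (w i) (w i).
    rewrite dotv_suml; apply: eq_bigr => i Pi; rewrite dotv_sumr (bigD1 i) //=.
    rewrite big1 ?addr0 => [|j /andP[_ ji]].
      by rewrite /dotv -scalemxAl [LHS]mxE.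
    apply: (@eigenspace_orth _ _ A (e i) (e j)) => //.
      by apply: contra ji => /eqP/inj_e->.
    by rewrite -scalemxAl wA !scalerA mulrC.
  exists (fun i => dotv (w i) (w i)) => [i|]; first exact: dotv_ge0.
  have dot1 : dotv (\sum_(i | P i) w i) (\sum_(i | P i) w i)
      = \sum_(i | P i) dotv (w i) (w i).
    transitivity (dotv (\sum_(i | P i) 1 *: w i) (\sum_(i | P i) w i)).
      by congr dotv; apply: eq_bigr => i _; rewrite scale1r.
    by rewrite dotE; apply: eq_bigr => i _; rewrite mul1r.
  split=> //; rewrite dot1 /qform mulmx_suml.
  rewrite (eq_bigr (fun i => e i *: w i)) => [|i _]; last exact: wA.
  by rewrite dotE mulr_sumr -sumrB; apply: eq_bigr => i _; rewrite mulrBl.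
exists (S (fun i => e i <= E)), (S (fun i => ~~ (e i <= E))); split.
- by rewrite rankS (eigen_countE _ symA inj_e eP).
- rewrite !rankS -(bigID (fun i => e i <= E) predT) /=.
  by have := rankS predT; rewrite /S eP mxrank1 => <-.
- move=> v /formS[d d0 [qE _]]; rewrite -subr_le0 qE sumr_le0 // => i iE.
  by rewrite mulr_le0_ge0 // subr_le0.
move=> v /formS[d d0 [qE dE]] v0; rewrite -subr_gt0 qE.
have := dotv_gt0 v0; rewrite dE => dgt0.
have : \sum_(i | ~~ (e i <= E)) (e i - E) * d i != 0.
  apply: contraL dgt0; rewrite psumr_eq0 => [/allP d_0|i iE]; last first.
    by rewrite mulr_ge0 // subr_ge0 ltW // real_ltNge ?num_real.
  rewrite big1 ?ltxx // => i iE.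
  have := d_0 i (mem_index_enum _); rewrite iE /= mulf_eq0 subr_eq0.
  by move=> /orP[/eqP ei|/eqP->//]; move: iE; rewrite ei lexx.
rewrite lt_neqAle eq_sym => -> /=; apply: sumr_ge0 => i iE.
by rewrite mulr_ge0 // subr_ge0 ltW // real_ltNge ?num_real.
Qed.

Lemma rank_cap_ge (F : fieldType) n m1 m2 (U : 'M[F]_(m1, n)) (V : 'M[F]_(m2, n)) :
  (\rank U + \rank V <= n + \rank (U :&: V)%MS)%N.
Proof. by rewrite -mxrank_sum_cap leq_add2r rank_leq_col. Qed.

(** Courant-Fischer: such a subspace meets the spectral subspace of the
    eigenvalues larger than E only in 0. *)
Lemma rank_le_eigen_count (R : realType) n (A : 'M[R]_n) E m (U : 'M[R]_(m, n)) :
  A^T = A -> (forall v : 'rV_n, (v <= U)%MS -> qform A v <= E * dotv v v) ->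
  (\rank U <= eigen_count A E)%N.
Proof.
move=> symA Ule; have [V [W [<- VW _ Wgt]]] := spectral_split E symA.
have UW0 : (U :&: W)%MS = 0.
  apply/eqP/rowV0P => v; rewrite sub_capmx => /andP[/Ule vU /Wgt vW].
  by apply/eqP; apply: contraLR vU => /vW; rewrite -real_ltNge ?num_real.
by have := rank_cap_ge U W; rewrite UW0 mxrank0; lia.
Qed.

Lemma rank_add_eigen_count_le (R : realType) n (A : 'M[R]_n) E m (U : 'M[R]_(m, n)) :
  A^T = A ->
  (forall v : 'rV_n, (v <= U)%MS -> v != 0 -> E * dotv v v < qform A v) ->
  (\rank U + eigen_count A E <= n)%N.
Proof.
move=> symA Ugt; have [V [W [<- VW Vle _]]] := spectral_split E symA.
have UV0 : (U :&: V)%MS = 0.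
  apply/eqP/rowV0P => v; rewrite sub_capmx => /andP[/Ugt vU /Vle vV].
  by apply/eqP; apply: contraLR vV => /vU; rewrite -real_ltNge ?num_real.
by have := rank_cap_ge U V; rewrite UV0 mxrank0 addn0.
Qed.

(** * Eigenvalue counts and block decompositions *)

(** The matrix that sends a row vector on the index set 'I_m to its copy on the
    range of f, extended by 0. *)
Definition incl_mx (R : pzSemiRingType) m n (f : 'I_m -> 'I_n) : 'M[R]_(m, n) :=
  \matrix_(i, l) (f i == l)%:R.

Lemma mul_incl_mx (R : pzSemiRingType) m n (f : 'I_m -> 'I_n) (v : 'rV[R]_n) i :
  (v *m (incl_mx R f)^T) 0 i = v 0 (f i).
Proof.
rewrite mxE (bigD1 (f i)) //= !mxE eqxx mulr1 big1 ?addr0 // => l fl.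
by rewrite !mxE eq_sym (negPf fl) mulr0.
Qed.

Lemma incl_mxK (R : pzSemiRingType) (I : finType) m n (f : I -> 'I_m -> 'I_n) s t :
  (forall s t i j, f s i = f t j -> s = t /\ i = j) ->
  incl_mx R (f s) *m (incl_mx R (f t))^T = if s == t then 1%:M else 0.
Proof.
move=> inj_f; apply/matrixP => i j; rewrite mxE (bigD1 (f s i)) //= big1 => [|l].
  rewrite !mxE eqxx mul1r addr0; case: (s =P t) => [->|st].
    rewrite mxE; case: (i =P j) => [->|ij]; rewrite ?eqxx //.
    by case: eqP => // /inj_f[_ /esym].
  by rewrite mxE; case: eqP => // /inj_f[/esym].
by rewrite !mxE eq_sym => /negPf->; rewrite mul0r.
Qed.

(** A acts as the block diagonal matrix of the B t on the rows outside bad, and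
    the bad rows do not contribute because v vanishes there. *)
Lemma qform_tiles (R : comNzRingType) (I : finType) m n (A : 'M[R]_n)
    (B : I -> 'M[R]_m) (f : I -> 'I_m -> 'I_n) (bad : {set 'I_n})
    (u : I -> 'rV[R]_m) (v : 'rV[R]_n) :
  (forall s t i j, f s i = f t j -> s = t /\ i = j) ->
  (forall t i, f t i \notin bad ->
     forall l, A (f t i) l = \sum_j B t i j * (f t j == l)%:R) ->
  v = \sum_t u t *m incl_mx R (f t) -> (forall l, l \in bad -> v 0 l = 0) ->
  qform A v = \sum_t qform (B t) (u t).
Proof.
move=> inj_f AB vE vbad.
have vf t i : v 0 (f t i) = u t 0 i.
  rewrite -mul_incl_mx vE mulmx_suml summxE (bigD1 t) //= big1 ?addr0 => [|s st].
    by rewrite -mulmxA incl_mxK // eqxx mulmx1.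
  by rewrite -mulmxA incl_mxK // (negPf st) mulmx0 mxE.
have Jv t : v *m (incl_mx R (f t))^T = u t.
  by apply/rowP => i; rewrite mul_incl_mx vf.
rewrite /qform {1}vE mulmx_suml dotv_suml; apply: eq_bigr => t _.
suff -> : u t *m incl_mx R (f t) *m A = u t *m B t *m incl_mx R (f t).
  have Jv' : incl_mx R (f t) *m v^T = (u t)^T by rewrite -Jv trmx_mul trmxK.
  by rewrite /dotv -(mulmxA (_ *m B t)) Jv'.
rewrite -!mulmxA; apply/rowP => l; rewrite !mxE; apply: eq_bigr => i _.
have [ibad|igood] := boolP (f t i \in bad).
  by rewrite -vf vbad // !mul0r.
congr (_ * _); rewrite !mxE (bigD1 (f t i)) //= big1 ?addr0 => [|l' l'i].
  by rewrite mxE eqxx mul1r AB //; apply: eq_bigr => j _; rewrite mxE.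
by rewrite mxE eq_sym (negPf l'i) mul0r.
Qed.

(** The orthogonal sum of the copies, inside a big space, of subspaces of the
    tiles. *)
Lemma tile_sum_space (F : fieldType) (I : finType) m n (f : I -> 'I_m -> 'I_n)
    (V : I -> 'M[F]_m) :
  (forall s t i j, f s i = f t j -> s = t /\ i = j) ->
  exists2 W : 'M[F]_n, \rank W = (\sum_t \rank (V t))%N &
    forall v : 'rV_n, (v <= W)%MS ->
      exists2 u : I -> 'rV_m, forall t, (u t <= V t)%MS &
        v = \sum_t u t *m incl_mx F (f t).
Proof.
move=> inj_f; exists (\sum_t <<V t *m incl_mx F (f t)>>)%MS; last first.
  move=> v /sub_sumsmxP[w ->].
  have wP t : exists x, w t *m <<V t *m incl_mx F (f t)>>%MS
                        = x *m (V t *m incl_mx F (f t)).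
    by apply/submxP; rewrite -(genmxE (V t *m _)) submxMl.
  have [x xP] := choice wP.
  exists (fun t => x t *m V t) => [t|]; first exact: submxMl.
  by apply: eq_bigr => t _; rewrite xP mulmxA.
have dxW : mxdirect (\sum_t <<V t *m incl_mx F (f t)>>)%MS.
  apply/mxdirect_sumsP => t _; apply/eqP/rowV0P => v.
  rewrite sub_capmx genmxE => /andP[/submxP[x vx] vs].
  have vJ0 : v *m (incl_mx F (f t))^T = 0.
    apply/eqP; rewrite -sub_kermx; apply: (submx_trans vs).
    apply/sumsmx_subP => s /= st; rewrite genmxE sub_kermx -!mulmxA incl_mxK //.
    by rewrite (negPf st) mulmx0.
  have : v *m (incl_mx F (f t))^T *m incl_mx F (f t) = v.
    by rewrite vx -!mulmxA (mulmxA (incl_mx F (f t))) incl_mxK // eqxx mul1mx.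
  by rewrite vJ0 mul0mx => <-.
rewrite (mxdirectP dxW) /=; apply: eq_bigr => t _; rewrite mxrank_gen mxrankMfree //.
by apply/row_freeP; exists (incl_mx F (f t))^T; rewrite incl_mxK // eqxx.
Qed.

Lemma vanishing_space (F : fieldType) n (bad : {set 'I_n}) :
  exists2 Z : 'M[F]_n, (n <= \rank Z + #|bad|)%N &
    forall v : 'rV_n, (v <= Z)%MS -> forall l, l \in bad -> v 0 l = 0.
Proof.
(* v C lists the coordinates of v at the bad indices. *)
pose C : 'M[F]_(n, #|bad|) := (incl_mx F (@enum_val _ (mem bad)))^T.
exists (kermx C) => [|v].
  by rewrite mxrank_ker; have := rank_leq_col C; lia.
rewrite sub_kermx => /eqP vC l lb; move/rowP: vC => /(_ (enum_rank_in lb l)).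
by rewrite mul_incl_mx enum_rankK_in // mxE.
Qed.

(** Both bounds come from a test space: the sum over the tiles of the low (resp.
    high) spectral subspaces of the B t, cut down to the vectors that vanish on
    the bad indices, which costs at most #|bad| dimensions.  The form of A on it
    is the sum of the forms of the B t.  Only the number of bad rows enters, not
    the size of their entries, so large vertex degrees do no harm. *)
Lemma eigen_count_tiles (R : realType) (I : finType) m n (A : 'M[R]_n)
    (B : I -> 'M[R]_m) (f : I -> 'I_m -> 'I_n) (bad : {set 'I_n}) (E : R) :
  A^T = A -> (forall t, (B t)^T = B t) ->
  (forall s t i j, f s i = f t j -> s = t /\ i = j) ->
  (forall t i, f t i \notin bad ->
     forall l, A (f t i) l = \sum_j B t i j * (f t j == l)%:R) ->
  (\sum_t eigen_count (B t) E <= eigen_count A E + #|bad|)%N /\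
  (eigen_count A E + #|I| * m <= \sum_t eigen_count (B t) E + n + #|bad|)%N.
Proof.
move=> symA symB inj_f AB.
have /choice[V /choice[W VW]] := fun t => spectral_split E (symB t).
have [Z rkZ Z0] := vanishing_space R bad.
have dotE (v : 'rV[R]_n) u : v = \sum_t u t *m incl_mx R (f t) ->
    dotv v v = \sum_t dotv (u t) (u t).
  move=> vE; have := @qform_tiles _ _ _ _ 1%:M (fun=> 1%:M) f finset.set0 u v inj_f.
  rewrite /qform mulmx1 => ->; rewrite ?inE //.
  - by apply: eq_bigr => t _; rewrite mulmx1.
  - move=> t i _ l; rewrite (bigD1 i) //= big1 ?addr0 => [|j ji].
      by rewrite !mxE eqxx mul1r.
    by rewrite !mxE eq_sym (negPf ji) mul0r.
  - by move=> l; rewrite inE.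
split.
  have [U rkU UP] := tile_sum_space V inj_f.
  have -> : (\sum_t eigen_count (B t) E = \rank U)%N.
    by rewrite rkU; apply: eq_bigr => t _; have [-> _ _ _] := VW t.
  have := @rank_le_eigen_count R n A E _ (U :&: Z)%MS symA.
  have := rank_cap_ge U Z; move=> h1 h2.
  suff /h2 h3 : forall v : 'rV_n, (v <= U :&: Z)%MS -> qform A v <= E * dotv v v.
    by move: h1 h3 rkZ; lia.
  move=> v; rewrite sub_capmx => /andP[/UP[u uV vE] /Z0 vZ].
  rewrite (qform_tiles inj_f AB vE vZ) (dotE _ _ vE) mulr_sumr.
  by apply: ler_sum => t _; have [_ _ + _] := VW t; apply.
have [U rkU UP] := tile_sum_space W inj_f.
have rkE : (\rank U + \sum_t eigen_count (B t) E = #|I| * m)%N.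
  rewrite rkU -big_split /= -sum_nat_const; apply: eq_bigr => t _.
  by have [<- VWm _ _] := VW t; rewrite addnC.
have := @rank_add_eigen_count_le R n A E _ (U :&: Z)%MS symA.
have := rank_cap_ge U Z; move=> h1 h2.
suff /h2 h3 : forall v : 'rV_n, (v <= U :&: Z)%MS -> v != 0 ->
    E * dotv v v < qform A v.
  by move: h1 h3 rkZ rkE; lia.
move=> v; rewrite sub_capmx => /andP[/UP[u uW vE] /Z0 vZ] v0.
rewrite (qform_tiles inj_f AB vE vZ) (dotE _ _ vE) mulr_sumr.
have [t0 ut0] : exists t, u t != 0.
  apply: contrapT => u0; move/eqP: v0; apply; rewrite vE big1 // => t _.
  have [->|ut] := eqVneq (u t) 0; first by rewrite mul0mx.
  by exfalso; apply: u0; exists t.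
rewrite (bigD1 t0) //= [ltRHS](bigD1 t0) //= ltr_leD //.
  by have [_ _ _] := VW t0; apply.
apply: ler_sum => t _; have [->|ut] := eqVneq (u t) 0.
  by rewrite /qform /dotv !mul0mx mxE mulr0.
by apply: ltW; have [_ _ _] := VW t; apply.
Qed.

Lemma eigen_count_le_dim (R : realType) n (A : 'M[R]_n) E :
  A^T = A -> (eigen_count A E <= n)%N.
Proof. by move=> /(spectral_split E)[V [W [<- VW _ _]]]; lia. Qed.

(** Immediately to the right of x there is no eigenvalue. *)
Lemma eigen_count_right_continuous (R : realType) n (A : 'M[R]_n) :
  A^T = A -> right_continuous (fun E => (eigen_count A E)%:R : R).
Proof.
move=> symA x; have [k [e [inj_e eP]]] := symmetric_spectrum symA.
apply: cvg_near_cst.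
have : \forall E \near x^'+, forall i, (e i <= E) = (e i <= x).
  apply: filter_forall => i; have [ix|xi] := leP (e i) x.
    near=> E; apply: (le_trans ix); apply: ltW; near: E; exact: nbhs_right_gt.
  near=> E; apply/negbTE; rewrite -ltNge; near: E; exact: nbhs_right_lt.
apply: filterS => E eE; congr (_%:R).
by rewrite !(eigen_countE _ symA inj_e eP); apply: eq_bigl => i; rewrite eE.
Unshelve. all: by end_near.
Qed.

(** * Laplacians and windows *)

Lemma adjC (G : groupType) (A : pred (edge G)) x y : adj A x y = adj A y x.
Proof. by rewrite /adj fsetUC. Qed.

Lemma vtx_in (G : groupType) (Q : {fset G}) (i : 'I_#|` Q|) : vtx i \in Q.
Proof. exact: mem_nth. Qed.

Lemma vtx_inj (G : groupType) (Q : {fset G}) : injective (@vtx G Q).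
Proof.
by move=> i j /eqP; rewrite nth_uniq ?fset_uniq // => /eqP/val_inj.
Qed.

Lemma vtx_onto (G : groupType) (Q : {fset G}) x :
  x \in Q -> exists i : 'I_#|` Q|, vtx i = x.
Proof.
move=> xQ; have h : (index x Q < #|` Q|)%N by rewrite index_mem.
by exists (Ordinal h); rewrite /vtx nth_index.
Qed.

Lemma laplacian_restr_sym (R : realType) (G : groupType) (w : config G)
    (Q : {fset G}) : (laplacian_restr R w Q)^T = laplacian_restr R w Q.
Proof.
apply/matrixP => i j; rewrite !mxE eq_sym adjC.
by case: eqP => // ->.
Qed.

Lemma laplacianE (R : realType) (G : groupType) (S : subgraph G) i j :
  laplacian R S i j = (i == j)%:R * #|[pred k : 'I_#|` vertices S| |
     adj (mem (edges S)) (vtx i) (vtx k)]|%:R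
    - (adj (mem (edges S)) (vtx i) (vtx j))%:R.
Proof.
rewrite /laplacian !mxE sumrB; congr (_ - _).
  rewrite eqxx sumr_const eq_sym /=; case: (i =P j) => [->|_].
    by rewrite mul1r.
  by rewrite mul0r mul0rn.
under eq_bigr => k _ do rewrite mxE eqxx /=.
rewrite adjC; have [ij|ij] := boolP (adj _ (vtx j) (vtx i)).
  by rewrite (bigD1 i) //= eqxx big1 ?addr0 // => k /andP[_ /negPf->].
by rewrite big1 // => k jk; case: eqP jk ij => // -> ->.
Qed.

Lemma laplacian_sym (R : realType) (G : groupType) (S : subgraph G) :
  (laplacian R S)^T = laplacian R S.
Proof.
apply/matrixP => i j; rewrite mxE !laplacianE eq_sym adjC.
by case: eqP => [->|_] //; rewrite !mul0r.
Qed.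

Lemma adj_edge (G : groupType) (A : pred (edge G)) (e : edge G) x y :
  val e = [fset x; y]%fset -> adj A x y = A e.
Proof. by move=> exy; rewrite /adj -exy valK. Qed.

Lemma edge_exists (G : groupType) (x y : G) : x != y ->
  exists e : edge G, val e = [fset x; y]%fset.
Proof.
move=> xy; have h : #|` [fset x; y]%fset| == 2%N by rewrite cardfs2 xy.
by exists (Sub [fset x; y]%fset h); rewrite SubK.
Qed.

Lemma adjxx (G : groupType) (A : pred (edge G)) x : adj A x x = false.
Proof. by rewrite /adj insubN // cardfs2 eqxx. Qed.

Lemma adjP (G : groupType) (A : pred (edge G)) x y : adj A x y ->
  exists2 e : edge G, val e = [fset x; y]%fset & A e.
Proof.
have [->|/edge_exists[e exy]] := eqVneq x y; first by rewrite adjxx.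
by rewrite (adj_edge _ exy); exists e.
Qed.

Definition edges_on (G : groupType) (Q : {fset G}) : {fset edge G} :=
  [fset e in pmap insub (fpowerset Q)]%fset.

Lemma in_edges_on (G : groupType) (Q : {fset G}) (e : edge G) :
  (e \in edges_on Q) = (val e `<=` Q)%fset.
Proof. by rewrite !inE mem_pmap_sub fpowersetE. Qed.

Fact shift_edge_subproof (G : groupType) (t : G) (e : edge G) :
  #|` [fset (x * t)%g | x in val e]%fset| == 2%N.
Proof. by rewrite card_imfset ?(eqP (valP e)) //; exact: mulIg. Qed.

Definition shift_edge (G : groupType) (t : G) (e : edge G) : edge G :=
  exist _ [fset (x * t)%g | x in val e]%fset (shift_edge_subproof t e).

Lemma shift_edgeE (G : groupType) (t : G) (e : edge G) x y :
  val e = [fset x; y]%fset -> val (shift_edge t e) = [fset (x * t)%g; (y * t)%g]%fset.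
Proof.
move=> exy; apply/fsetP => z; rewrite /= exy !inE; apply/imfsetP/orP => /=.
  by move=> [u]; rewrite !inE => /orP[]/eqP-> ->; [left|right].
by move=> [/eqP->|/eqP->]; [exists x|exists y]; rewrite ?inE ?eqxx ?orbT.
Qed.

Lemma shift_edge_inj (G : groupType) (t : G) : injective (shift_edge t).
Proof.
move=> e e' /(congr1 val) /= ee'; apply/val_inj/fsetP => x.
have h (B : {fset G}) : (x \in B) = ((x * t)%g \in [fset (x * t)%g | x in B]%fset).
  by apply/idP/imfsetP => [xB|[y yB /mulIg->//]]; exists x.
by rewrite !h ee'.
Qed.

Fact window_subproof (G : groupType) (w : config G) (Q : {fset G}) (t : G) :
  all (fun e => val e `<=` Q)%fset
    [fset e in edges_on Q | (w : edge G -> bool) (shift_edge t e)]%fset.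
Proof. by apply/allP => e; rewrite !inE /= => /andP[]; rewrite mem_pmap_sub fpowersetE. Qed.

(** The graph seen by w inside the tile Q t, pulled back to Q by the right
    translation by t^-1. *)
Definition window (G : groupType) (w : config G) (Q : {fset G}) (t : G) : subgraph G :=
  exist _ (Q, [fset e in edges_on Q | (w : edge G -> bool) (shift_edge t e)]%fset)
    (window_subproof w Q t).

Lemma in_edges_window (G : groupType) (w : config G) (Q : {fset G}) t e :
  (e \in edges (window w Q t)) =
    (val e `<=` Q)%fset && (w : edge G -> bool) (shift_edge t e).
Proof. by rewrite -in_edges_on /edges /= !inE. Qed.

Lemma adj_window (G : groupType) (w : config G) (Q : {fset G}) t x y :
  x \in Q -> y \in Q ->
  adj (mem (edges (window w Q t))) x y = adj w (x * t)%g (y * t)%g.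
Proof.
move=> xQ yQ; have [->|/edge_exists[e exy]] := eqVneq x y; first by rewrite !adjxx.
rewrite (adj_edge _ exy) (adj_edge _ (shift_edgeE t exy)) /=.
rewrite -[LHS]/(e \in edges (window w Q t)) in_edges_window exy.
by rewrite fsubUset !fsub1set xQ yQ.
Qed.

(** * Cutting a finite set along tiles *)

Definition tiling (G : groupType) (Q : {fset G}) (T : set G) : Prop :=
  [/\ Q != fset0%fset,
      forall x, exists q t, [/\ q \in Q, T t & x = (q * t)%g] &
      forall q t q' t', q \in Q -> T t -> q' \in Q -> T t' ->
        (q * t = q' * t')%g -> q = q' /\ t = t'].

Lemma monotile_tiling (G : groupType) (Q : {fset G}) :
  Q != fset0%fset -> monotile Q -> exists T, tiling Q T.
Proof.
move=> Q0 [T /= [Tcov Ttriv]]; exists T; split=> // [x|q t q' t' qQ Tt qQ' Tt' e].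
  have : [set: G] x by [].
  by rewrite -Tcov => -[t Tt [q qQ <-]]; exists q, t.
have tt' : t = t'.
  by apply: Ttriv => //; exists (q * t)%g; split; [exists q|exists q'].
by split=> //; move: e; rewrite tt' => /mulIg.
Qed.

Definition inner_tiles (G : groupType) (Q : {fset G}) (T : set G) (D : {fset G}) :
    {fset G} :=
  [fset t in [fset (q^-1 * x)%g | q in Q, x in D]
    | `[< T t /\ forall q, q \in Q -> (q * t)%g \in D >]]%fset.

Lemma inner_tilesP (G : groupType) (Q : {fset G}) (T : set G) (D : {fset G}) t :
  Q != fset0%fset ->
  reflect (T t /\ forall q, q \in Q -> (q * t)%g \in D) (t \in inner_tiles Q T D).
Proof.
move=> Q0; rewrite !inE; apply: (iffP andP) => [[_ /asboolP]//|h].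
have [q qQ] := fset0Pn _ Q0; split; last exact/asboolP.
by apply/imfset2P; exists q => //; exists (q * t)%g; rewrite ?mulKg //; apply: h.2.
Qed.

(** The vertices at which cutting along the tiles is visible.  A vertex of
    infinite degree in an inner tile is escaping, since its tile is finite. *)
Definition escaping (G : groupType) (w : config G) (Q : {fset G}) (T : set G)
    (D : {fset G}) : {fset G} :=
  [fset x in D | `[< exists q t y, [/\ q \in Q, t \in inner_tiles Q T D,
     x = (q * t)%g, adj w x y & (y * t^-1)%g \notin Q] >]]%fset.

(** The rows of the two Laplacians agree at a vertex that does not escape: all
    its neighbours are in its own tile, so that its degree in the whole graph
    is its degree in the window. *)
Lemma F_count_tiles (R : realType) (G : groupType) (w : config G) (Q : {fset G})
    (T : set G) (D : {fset G}) (E : R) : tiling Q T ->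
  (\sum_(t <- inner_tiles Q T D) Ftilde_count (window w Q t) E
     <= F_count w D E + #|` escaping w Q T D|)%N /\
  (F_count w D E + #|` inner_tiles Q T D| * #|` Q|
     <= \sum_(t <- inner_tiles Q T D) Ftilde_count (window w Q t) E
        + #|` D| + #|` escaping w Q T D|)%N.
Proof.
move=> [Q0 Tcov Tuniq]; set I := inner_tiles Q T D.
have tile_in (t : I) (i : 'I_#|` Q|) : exists l : 'I_#|` D|, vtx l = (vtx i * val t)%g.
  apply: vtx_onto; have /(inner_tilesP _ _ _ Q0)[_] := valP t.
  by apply; exact: (@vtx_in _ Q).
have /choice[f fP] : forall t : I, exists g : 'I_#|` Q| -> 'I_#|` D|,
    forall i, vtx (g i) = (vtx i * val t)%g.
  by move=> t; have [g gP] := choice (tile_in t); exists g => i; exact: gP.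
have IT (t : I) : T (val t) by have /(inner_tilesP _ _ _ Q0)[] := valP t.
have inj_f s t i j : f s i = f t j -> s = t /\ i = j.
  move=> /(congr1 (@vtx G D)); rewrite !fP.
  by move=> /(Tuniq _ _ _ _ (vtx_in i) (IT s) (vtx_in j) (IT t))[/vtx_inj-> /val_inj->].
pose bad := [set l : 'I_#|` D| | vtx l \in escaping w Q T D]%SET.
have bad_le : (#|bad| <= #|` escaping w Q T D|)%N.
  rewrite cardE -(size_map (@vtx G D)); apply: uniq_leq_size.
    by rewrite map_inj_uniq ?enum_uniq //; exact: vtx_inj.
  by move=> x /mapP[l]; rewrite mem_enum inE => ? ->.
pose B (t : I) : 'M[R]_#|` Q| := laplacian R (window w Q (val t)).
have BE t i j : B t i j = (i == j)%:R *
      #|[pred k : 'I_#|` Q| | adj w (vtx i * val t)%g (vtx k * val t)%g]|%:R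
    - (adj w (vtx i * val t)%g (vtx j * val t)%g)%:R.
  rewrite [LHS](@laplacianE R G (window w Q (val t)) i j).
  rewrite [in X in _ - X]adj_window; [|exact: (@vtx_in _ Q)..].
  congr (_ * (_)%:R - _); apply: (@eq_card 'I_#|` Q|) => k; rewrite !inE.
  by rewrite adj_window //; exact: (@vtx_in _ Q).
have AB t i : f t i \notin bad -> forall l,
    laplacian_restr R w D (f t i) l = \sum_j B t i j * (f t j == l)%:R.
  rewrite inE => iNbad l; set x := (vtx i * val t)%g.
  have xD : x \in D by rewrite /x -fP vtx_in.
  have esc y : adj w x y -> exists j : 'I_#|` Q|, y = (vtx j * val t)%g.
    move=> xy; have /vtx_onto[j jE] : (y * (val t)^-1)%g \in Q.
      apply: contraNT iNbad => yQ; rewrite !inE fP -/x xD /=; apply/asboolP.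
      by exists (vtx i), (val t), y; split=> //; [exact: vtx_in | exact: valP].
    by exists j; rewrite jE mulgVK.
  rewrite mxE !fP -/x.
  have [[j0 <-]|lNf] := pselect (exists j, f t j = l).
    rewrite (bigD1 j0) //= eqxx mulr1 big1 => [|j jj0]; last first.
      by case: eqP => [/inj_f[_ jE]|_]; rewrite ?mulr0 //; rewrite jE eqxx in jj0.
    rewrite addr0 BE fP -/x; case: (f t i =P f t j0) => [/inj_f[_ <-]|ij].
      rewrite eqxx mul1r adjxx subr0 /degree; congr (_%:R).
      pose X := [fset (vtx k * val t)%g | k in [pred k : 'I_#|` Q| |
                  adj w x (vtx k * val t)%g]]%fset.
      have -> : [set y | adj w x y] = [set` X].
        apply/seteqP; split=> y /=.
          move=> xy; have [j yE] := esc _ xy; apply/imfsetP; exists j => //=.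
          by move: xy; rewrite yE.
        by move=> /imfsetP[j /= + ->].
      rewrite set_fsetK card_imfset; last by move=> j k /mulIg/vtx_inj.
      by rewrite -cardE; apply: eq_card => k; rewrite !inE.
    have /negPf -> : i != j0 by apply: contra_notN ij => /eqP->.
    by rewrite mul0r sub0r; case: adj; rewrite ?oppr0.
  rewrite big1 => [|j _]; last by case: eqP => [ft|_]; rewrite ?mulr0 //; case: lNf; exists j.
  case: eqP => [fl|_]; first by case: lNf; exists i.
  case: ifP => // /esc[j jl]; case: lNf; exists j; apply: vtx_inj.
  by rewrite fP jl.
have symB t : (B t)^T = B t by exact: (laplacian_sym R (window w Q (val t))).
have [] := eigen_count_tiles E (laplacian_restr_sym R w D) symB inj_f AB.
have -> : (\sum_t eigen_count (B t) E = \sum_(t <- I) Ftilde_count (window w Q t) E)%N.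
  by rewrite big_seq_fsetE.
rewrite -cardfE -/(F_count w D E); move: bad_le; set a := #|bad|.
set b := F_count _ _ _; set c := (\sum_(t <- I) _)%N; lia.
Qed.

(** * Large deviations of independent events *)

Lemma expR_le_quadratic (R : realType) (l : R) : l <= 2^-1 ->
  expR l <= 1 + l + 2 * l ^+ 2.
Proof.
move=> l2; have h1 : 0 < 1 - l by lra.
have e1 : 1 - l <= expR (- l) by exact: expR_ge1Dx.
have e2 : expR l * (1 - l) <= 1.
  by rewrite -[X in _ <= X](expRxMexpNx_1 l) ler_wpM2l ?expR_ge0.
rewrite -(ler_pM2r h1); apply: (le_trans e2).
have : 0 <= l ^+ 2 * (1 - 2 * l) by apply: mulr_ge0; [exact: sqr_ge0|lra].
nra.
Qed.

Lemma mem_bigcap_finset (T : Type) (I : finType) (C : I -> set T) (J : {set I}) x :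
  (x \in \bigcap_(i in [set` J]) C i) = [forall i in J, x \in C i].
Proof.
apply/idP/'forall_implyP => [|h].
  by rewrite inE => h i iJ; rewrite inE; apply: h.
by rewrite inE => i /= iJ; have := h i iJ; rewrite inE.
Qed.

(** Expanding the product over the subsets J of I turns it into a combination of
    the indicators of the intersections, whose probabilities factorize. *)
Lemma indep_mgf d (T : measurableType d) (R : realType) (mu : probability T R)
    (I : finType) (C : I -> set T) (q : I -> R) (a : R) :
  (forall i, measurable (C i)) ->
  (forall J : {set I}, mu (\bigcap_(i in [set` J]) C i) = (\prod_(i in J) q i)%:E) ->
  (\int[mu]_x (\prod_i (1 + a * \1_(C i) x))%:E = (\prod_i (1 + a * q i))%:E)%E.
Proof.
move=> mC indep; pose D (J : {set I}) := \bigcap_(i in [set` J]) C i.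
have mD J : measurable (D J).
  by apply: fin_bigcap_measurable => //; exact: finite_finset.
have expand x : \prod_i (1 + a * \1_(C i) x)
    = \sum_(J : {set I}) (\prod_(i in J) a) * \1_(D J) x.
  under eq_bigr do rewrite addrC.
  rewrite bigA_distr; apply: eq_bigr => J _; rewrite -big_mkcond big_split /=.
  congr (_ * _); rewrite indicE mem_bigcap_finset.
  have [/'forall_implyP h|] := boolP [forall i in J, x \in C i].
    by rewrite big1 // => i /h xi; rewrite indicE xi.
  rewrite negb_forall => /existsP[i]; rewrite negb_imply => /andP[iJ xi].
  by rewrite (bigD1 i) //= indicE (negPf xi) mul0r.
under eq_integral => x _ do rewrite expand -sumEFin.
rewrite integral_sum //; last first.
  move=> J; under eq_fun do rewrite EFinM.
  by apply: integrableZl => //; exact: integrable_indic.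
rewrite (eq_bigr (fun J : {set I} => (\prod_(i in J) (a * q i))%:E)); last first.
  move=> J _; under eq_integral do rewrite EFinM.
  rewrite integralZl //; last exact: integrable_indic.
  by rewrite integral_indic // setIT [X in (_ * X)%E]indep -EFinM -big_split.
rewrite sumEFin; congr (_%:E); under [RHS]eq_bigr do rewrite addrC.
by rewrite bigA_distr; apply: eq_bigr => J _; rewrite -big_mkcond.
Qed.

(** A negative l gives the lower tail and a positive one the upper tail of the
    number of events that occur. *)
Lemma indep_chernoff d (T : measurableType d) (R : realType) (mu : probability T R)
    (I : finType) (C : I -> set T) (q : I -> R) (l k : R) :
  (forall i, measurable (C i)) -> (forall i, 0 <= q i <= 1) ->
  (forall J : {set I}, mu (\bigcap_(i in [set` J]) C i) = (\prod_(i in J) q i)%:E) ->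
  l <= 2^-1 ->
  measurable [set x | l * k <= l * \sum_i \1_(C i) x] /\
  (mu [set x | l * k <= l * \sum_i \1_(C i) x]%R
     <= (expR ((l + 2 * l ^+ 2) * (\sum_i q i) - l * k))%:E)%E.
Proof.
move=> mC q01 indep l2; set A := [set x | _].
have mX : measurable_fun [set: T] (fun x => l * \sum_i \1_(C i) x : R).
  apply: measurable_funM => //; apply: measurable_sum => i.
  exact: measurable_indic.
have mA : measurable A.
  have := mX measurableT `[l * k, +oo[%classic (measurable_itv _).
  rewrite setTI; congr (measurable _); apply/seteqP; split=> x /=;
  by rewrite in_itv /= andbT.
split=> //; set a := expR l - 1.
(* The exponential Markov inequality, pointwise. *)
have markov x : \1_A x <= expR (- (l * k)) * \prod_i (1 + a * \1_(C i) x).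
  have -> : \prod_i (1 + a * \1_(C i) x) = expR (l * \sum_i \1_(C i) x).
    rewrite mulr_sumr expR_sum; apply: eq_bigr => i _; rewrite indicE /a.
    by case: (_ \in _); rewrite ?mulr1 ?mulr0 ?expR0 ?addr0 // addrC subrK.
  rewrite -expRD indicE; have [|_] := boolP (x \in A); last exact: expR_ge0.
  rewrite inE /A /= => h; rewrite -expR0 ler_expR addrC subr_ge0 //.
rewrite -(setIT A) -integral_indic //.
apply: (@le_trans _ _ (\int[mu]_x
    (expR (- (l * k)) * \prod_i (1 + a * \1_(C i) x))%:E)%E).
  apply: ge0_le_integral => //.
  - by apply/measurable_EFinP; exact: measurable_indic.
  - apply/measurable_EFinP; apply: measurable_funM => //.
    apply: measurable_prod => i _; apply: measurable_funD => //.
    by apply: measurable_funM => //; exact: measurable_indic.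
  - by move=> x _; rewrite lee_fin.
under eq_integral do rewrite EFinM.
rewrite ge0_integralZl //; last 2 first.
- apply/measurable_EFinP; apply: measurable_prod => i _; apply: measurable_funD => //.
  by apply: measurable_funM => //; exact: measurable_indic.
- move=> x _; rewrite lee_fin prodr_ge0 // => i _; rewrite indicE /a.
  by case: (_ \in _); rewrite ?mulr1 ?mulr0 ?addr0 // addrC subrK expR_ge0.
rewrite (indep_mgf _ mC indep) -EFinM lee_fin addrC expRD ler_wpM2l ?expR_ge0 //.
have alow : -1 <= a by rewrite /a; have := expR_ge0 l; lra.
apply: (@le_trans _ _ (\prod_i expR (a * q i))).
  apply: ler_prod => i _; rewrite expR_ge1Dx andbT.
  by have /andP[] := q01 i; nra.
rewrite -expR_sum -mulr_sumr ler_expR ler_wpM2r //.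
  by apply: sumr_ge0 => i _; have /andP[] := q01 i.
by rewrite /a; have := expR_le_quadratic l2; lra.
Qed.

Lemma measurable_cylinder (G : groupType) (A : {fset edge G}) c :
  measurable (cylinder A c : set (config G)).
Proof. by apply: sub_sigma_algebra; exists A, c. Qed.

(** An intersection of cylinders over disjoint sets of edges is a cylinder over
    their union. *)
Lemma cylinder_indep (R : realType) (G : groupType) (p : G -> R)
    (mu : probability (config G) R) (I : finType) (A : I -> {fset edge G})
    (c : I -> edge G -> bool) (J : {set I}) :
  percolation_measure p mu ->
  (forall i j, i != j -> [disjoint A i & A j]%fset) ->
  mu (\bigcap_(i in [set` J]) cylinder (A i) (c i)) =
    (\prod_(i in J) \prod_(e <- A i)
       (if c i e then edge_prob p e else 1 - edge_prob p e))%:E.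
Proof.
move=> mu_perc disjA; pose K := [fset i in J]%fset.
(* By disjointness the prescriptions c i combine into a single one. *)
pose c' e := [exists i in J, (e \in A i) && c i e].
have c'E i e : i \in J -> e \in A i -> c' e = c i e.
  move=> iJ eA; apply/existsP/idP => [[j /and3P[jJ eAj cj]]|ci]; last first.
    by exists i; rewrite iJ eA.
  have [<-//|ij] := eqVneq j i.
  by have /fdisjointP/(_ _ eAj) := disjA _ _ ij; rewrite eA.
have -> : \bigcap_(i in [set` J]) cylinder (A i) (c i)
    = cylinder (\bigcup_(i <- K) A i)%fset c'.
  apply/seteqP; split=> w /= h.
    move=> e /bigfcupP[i /andP[]]; rewrite !inE => iJ _ eA.
    by rewrite (c'E i) //; apply: h.
  move=> i /= iJ e eA; rewrite -(c'E i e) //; apply: h.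
  by apply/bigfcupP; exists i => //; rewrite !inE iJ.
rewrite mu_perc partition_disjoint_bigfcup => [|i j _ _]; last exact: disjA.
congr (_%:E); rewrite big_imfset //= big_enum; apply: eq_bigr => i iJ.
by rewrite big_seq [RHS]big_seq; apply: eq_bigr => e eA; rewrite (c'E i).
Qed.

Lemma measure_bigcup_le d (T : measurableType d) (R : realType)
    (mu : {measure set T -> \bar R}) (A : nat -> set T) (c : \bar R) :
  (forall n, measurable (A n)) -> nondecreasing_seq A ->
  (forall n, (mu (A n) <= c)%E) -> (mu (\bigcup_n A n) <= c)%E.
Proof.
move=> mA ndA muA.
have h : mu \o A @ \oo --> mu (\bigcup_n A n).
  by apply: nondecreasing_cvg_mu => //; exact: bigcup_measurable.
rewrite -(cvg_lim _ h) //; apply: lime_le; first by apply/cvg_ex; eexists; exact: h.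
exact: nearW.
Qed.

Lemma ae_eventually_not d (T : measurableType d) (R : realType)
    (mu : {measure set T -> \bar R}) (A : nat -> set T) (r : R) :
  0 < r -> (forall n, measurable (A n)) ->
  (forall n, (mu (A n) <= (expR (- r * n%:R))%:E)%E) ->
  {ae mu, forall x, \forall n \near \oo, ~ A n x}.
Proof.
move=> r0 mA muA.
have : mu (lim_sup_set A) = 0%E.
  apply: lim_sup_set_cvg0 => //.
  pose z := expR (- r).
  have z1 : `|z| < 1 by rewrite ger0_norm ?expR_ge0 // -expR0 ltr_expR oppr_lt0.
  have h : (\sum_(0 <= n < k) (geometric 1 z n)%:E)%E @[k --> \oo]
      --> ((1 * (1 - z)^-1)%:E : \bar R).
    apply/fine_cvgP; split.
      by apply: nearW => n; rewrite sumEFin.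
    have := @cvg_geometric_series R 1 z z1; apply: cvg_trans.
    apply: near_eq_cvg; apply: nearW => n /=.
    by rewrite sumEFin.
  apply: (@le_lt_trans _ _ (\sum_(0 <= n <oo) (geometric 1 z n)%:E)%E).
    apply: lee_lim.
    - exact: is_cvg_ereal_nneg_natsum_cond.
    - by apply/cvg_ex; eexists; exact: h.
    - apply: nearW => /= n; apply: lee_sum => i _.
      by rewrite (le_trans (muA i)) // lee_fin mul1r /z -expRM_natr.
  by move/cvg_lim : h => ->//; rewrite ltry.
move=> limsup0; exists (lim_sup_set A); split => //.
  by apply: bigcap_measurable => // k _; exact: bigcup_measurable.
move=> x /= nx N _ /=; apply: contrapT => h; apply: nx; exists N => // n /= Nn Ax.
by apply: h; exists n.
Qed.

(** * Folner estimates *)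

Lemma big_fset_swap (T : choiceType) (R : nmodType) (A B : {fset T}) (P : pred T)
    (f : T -> R) :
  \sum_(x <- A | P x && (x \in B)) f x = \sum_(x <- B | P x && (x \in A)) f x.
Proof.
rewrite -big_filter -[RHS]big_filter; apply: perm_big; apply: uniq_perm.
- by rewrite filter_uniq.
- by rewrite filter_uniq.
by move=> x; rewrite !mem_filter -!andbA (andbC (x \in A)).
Qed.

Lemma ler_sum_cond (R : numDomainType) (I : Type) (r : seq I) (P Q : pred I)
    (f : I -> R) : (forall i, 0 <= f i) -> (forall i, P i -> Q i) ->
  \sum_(i <- r | P i) f i <= \sum_(i <- r | Q i) f i.
Proof.
move=> f0 PQ; rewrite big_mkcond [leRHS]big_mkcond; apply: ler_sum => i _.
by case: ifP => [/PQ->//|_]; case: ifP.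
Qed.

Lemma summable_tail (T : choiceType) (R : realType) (p : T -> R) (e : R) :
  (forall x, 0 <= p x) -> summable [set: T] (fun x => (p x)%:E) -> 0 < e ->
  exists K : {fset T}, forall L : {fset T}, \sum_(g <- L | g \notin K) p g <= e.
Proof.
move=> p0 psum e0.
pose S := [set (\sum_(x \in A) (p x)%:E)%E | A in fsets [set: T]].
have S_esum : ereal_sup S = (\esum_(x in [set: T]) `|(p x)%:E|)%E.
  by apply: eq_esum => x _; rewrite /= ger0_norm.
have SFin : ereal_sup S \is a fin_num by rewrite S_esum -summableE.
have [_ [A [finA _] <-] AS] := ub_ereal_sup_adherent e0 SFin.
exists (fset_set A) => L; set K := fset_set A; pose M := (K `|` L)%fset.
have MS : ((\sum_(x <- M) p x)%:E <= ereal_sup S)%E.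
  apply: ereal_sup_ubound; exists [set` M]; first by split.
  by rewrite -fsbig_seq ?fset_uniq // sumEFin.
move: AS; rewrite fsbig_finite // sumEFin -/K lteBlDr // => AS.
have := le_lt_trans MS AS; rewrite -EFinD lte_fin (bigID (mem K)) /=.
have -> : \sum_(x <- M | x \in K) p x = \sum_(x <- K) p x.
  rewrite -big_filter; apply: perm_big; apply: uniq_perm.
  - by rewrite filter_uniq.
  - exact: fset_uniq.
  by move=> x; rewrite mem_filter !inE; case: (x \in K).
have -> : \sum_(x <- M | x \notin K) p x = \sum_(x <- L | x \notin K) p x.
  rewrite -big_filter -[RHS]big_filter; apply: perm_big; apply: uniq_perm.
  - by rewrite filter_uniq.
  - by rewrite filter_uniq.
  by move=> x; rewrite !mem_filter !inE; case: (x \in K).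
by lra.
Qed.

Notation boundary K Q := ([fset (k * q)%g | k in K, q in Q] `\` Q)%fset.

(** Only finitely many g carry all of the mass of p but e / 2, and for each of
    them the q in Q n with g q outside Q n form a negligible fraction of Q n.
    The finite sets L q stand for the infinite sums over g. *)
Lemma folner_boundary_mass (R : realType) (G : groupType) (p : G -> R)
    (Q : nat -> {fset G}) (e : R) :
  (forall x, 0 <= p x) -> summable [set: G] (fun x => (p x)%:E) ->
  folner R Q -> 0 < e ->
  \forall n \near \oo, forall L : G -> {fset G},
    \sum_(q <- Q n) \sum_(g <- L q | (g * q)%g \notin Q n) p g <= e * #|` Q n|%:R.
Proof.
move=> p0 psum [Q0 QK] e0.
have [K Ktail] := summable_tail p0 psum (divr_gt0 e0 (ltr0Sn R 1)).
pose s := \sum_(g <- K) p g; have s0 : 0 <= s by apply: sumr_ge0.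
have e'0 : 0 < e / 2 / (s + 1) by rewrite !divr_gt0 // ltr_wpDl.
have /cvgrPdist_le /(_ _ e'0) := QK K; apply: filterS => n; rewrite sub0r normrN.
rewrite ger0_norm ?divr_ge0 // => Qn L.
have cQ : 0 < #|` Q n|%:R :> R by rewrite ltr0n cardfs_gt0.
rewrite ler_pdivrMr // in Qn.
have cardK g : g \in K ->
    (\sum_(q <- Q n | (g * q)%g \notin Q n) 1 <= #|` boundary K (Q n)|)%N.
  move=> gK; rewrite sum1_count -size_filter -(size_map (fun q => (g * q)%g)).
  apply: uniq_leq_size.
    by rewrite map_inj_uniq ?filter_uniq //; exact: mulgI.
  move=> x /mapP[q]; rewrite mem_filter => /andP[gq qQ] ->.
  rewrite !inE gq; apply/imfset2P; exists g => //; exists q => //.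
have part1 : \sum_(q <- Q n) \sum_(g <- K | (g * q)%g \notin Q n) p g
    <= s * #|` boundary K (Q n)|%:R.
  rewrite (exchange_big_dep xpredT) //= /s mulr_suml big_seq [leRHS]big_seq.
  apply: ler_sum => g gK; rewrite mulr_natr big_const_seq iter_addr_0.
  by apply: ler_wpMn2l => //; rewrite -sum1_count cardK.
apply: (@le_trans _ _ (\sum_(q <- Q n)
    (\sum_(g <- K | (g * q)%g \notin Q n) p g + e / 2))).
  apply: ler_sum => q _; rewrite (bigID (mem K)) /= lerD //.
    by rewrite big_fset_swap; apply: ler_sum_cond => // g /andP[].
  apply: le_trans (Ktail (L q)); apply: ler_sum_cond => // g /andP[_] //.
rewrite big_split /= big_const_seq iter_addr_0 count_predT -mulr_natr.
have e1 : s * (e / 2 / (s + 1)) <= e / 2.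
  rewrite mulrA ler_pdivrMr ?ltr_wpDl // mulrC ler_wpM2l //; [lra|lra].
have e2 : s * #|` boundary K (Q n)|%:R <= e / 2 * #|` Q n|%:R.
  apply: (le_trans (ler_wpM2l s0 Qn)); rewrite mulrA ler_wpM2r //.
by apply: (le_trans (lerD (le_trans part1 e2) (lexx _))); lra.
Qed.

(** A point of D in a tile that sticks out of D is moved out of D by one of the
    q' q^-1, so it is a translate of a point of the boundary of D. *)
Lemma inner_tiles_card (G : groupType) (Q : {fset G}) (T : set G) (D : {fset G}) :
  tiling Q T ->
  (#|` inner_tiles Q T D| * #|` Q| <= #|` D|
     <= #|` inner_tiles Q T D| * #|` Q|
        + #|` Q| ^ 2 * #|` boundary [fset (q * q'^-1)%g | q in Q, q' in Q]%fset D|)%N.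
Proof.
move=> [Q0 Tcov Tuniq]; set I := inner_tiles Q T D.
have IP t : reflect (T t /\ forall q, q \in Q -> (q * t)%g \in D) (t \in I).
  exact: inner_tilesP.
have inj_h : {in [pred z : {t : G & G} | (tag z \in I) && (tagged z \in Q)] &,
    injective (fun z : {t : G & G} => (tagged z * tag z)%g)}.
  move=> [t q] [t' q'] /andP[/= /IP[Tt _] qQ] /andP[/= /IP[Tt' _] qQ'].
  by move=> /(Tuniq _ _ _ _ qQ Tt qQ' Tt')[-> ->].
set U := [fset (q * t)%g | t in I, q in Q]%fset.
have UP x : reflect (exists q t, [/\ q \in Q, t \in I & x = (q * t)%g]) (x \in U).
  apply: (iffP (imfset2P _ _ _ _ _)) => [[t /= tI [q /= qQ ->]]|].
    by exists q, t.
  by move=> [q [t [qQ tI ->]]]; exists t => //; exists q.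
have <- : (#|` U| = #|` I| * #|` Q|)%N.
  rewrite -sum1_size big_imfset2 // (eq_bigr (fun=> #|` Q|)) => [|t _]; last first.
    exact: sum1_size.
  by rewrite big_const_seq count_predT [LHS]iter_addn_0 mulnC.
apply/andP; split.
  apply: fsubset_leq_card.
  by apply/fsubsetP => x /UP[q [t [qQ /IP[_ h] ->]]]; apply: h.
set K := [fset (q * q'^-1)%g | q in Q, q' in Q]%fset.
pose C := [seq (q * q'^-1)%g | q <- Q, q' <- Q].
pose W := [fset x in [seq (c * y)%g | c <- C, y <- boundary K D]]%fset.
have : (D `<=` U `|` W)%fset.
  apply/fsubsetP => x xD; rewrite in_fsetU; have [//|xU /=] := boolP (x \in U).
  have [q [t [qQ Tt xE]]] := Tcov x.
  have [q' qQ' q'D] : exists2 q', q' \in Q & (q' * t)%g \notin D.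
    apply: contrapT => h; move/UP: xU; apply; exists q, t; split=> //; apply/IP.
    by split=> // q' qQ'; apply: contrapT => /negP q'D; apply: h; exists q'.
  (* x = q t is a translate of q' t = (q' q^-1) x, which lies just outside D. *)
  rewrite in_fset; apply/allpairsP; exists ((q * q'^-1)%g, (q' * t)%g) => /=.
  split; last by rewrite mulgA mulgVK.
    by apply/allpairsP; exists (q, q').
  rewrite in_fsetD q'D /=; apply/imfset2P.
  exists (q' * q^-1)%g; first by apply/imfset2P; exists q' => //; exists q.
  by exists x => //; rewrite xE mulgA mulgVK.
move=> /fsubset_leq_card/leq_trans; apply.
rewrite (leq_trans (leq_card_fsetU U W).1) // leq_add2l card_fseq.
by rewrite (leq_trans (size_undup _)) // !size_allpairs mulnn.
Qed.

(** G is countable, being finitely generated. *)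
Lemma exhaustion (G : groupType) (P : {fset G}) : generates P ->
  exists L : nat -> {fset G}, (forall m n, (m <= n)%N -> (L m `<=` L n)%fset) /\
    forall F : {fset G}, exists n, (F `<=` L n)%fset.
Proof.
move=> genP.
(* Words in the generators are coded by sequences of indices in P. *)
pose g (n : nat) := if (choice.unpickle n : option (seq nat)) is Some s
            then (\prod_(i <- s) nth 1 P i)%g else 1%g.
have g_onto x : exists n, g n = x.
  have [s sP ->] := genP x; exists (choice.pickle (map (fun y => index y P) s)).
  rewrite /g choice.pickleK big_map big_seq [RHS]big_seq.
  by apply: eq_bigr => y /sP yP; rewrite nth_index.
pose L n := [fset g i | i in iota 0 n]%fset.
have Lmono m n : (m <= n)%N -> (L m `<=` L n)%fset.
  move=> mn; apply/fsubsetP => x /imfsetP[i /=]; rewrite mem_iota add0n => im ->.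
  by apply/imfsetP; exists i => //=; rewrite mem_iota (leq_trans im).
exists L; split=> // F; elim/finSet_rect: F => F IH.
have [->|/fset0Pn[x xF]] := eqVneq F fset0; first by exists 0%N; exact: fsub0set.
have [n Fn] := IH _ (fproperD1 xF); have [k gk] := g_onto x.
exists (maxn n k.+1); rewrite -(fsetD1K xF) fsubUset fsub1set.
rewrite (fsubset_trans Fn) ?Lmono ?leq_maxl // andbT.
by apply/imfsetP; exists k => //=; rewrite mem_iota add0n leq_maxr.
Qed.

(** * Edges that leave their tile *)

(** The edges that leave an inner tile.  There may be infinitely many of them, so
    the end point outside the tile is restricted to the finite set D `|` V. *)
Definition crossing (G : groupType) (Q : {fset G}) (T : set G) (D V : {fset G}) :
    {fset edge G} :=
  [fset e in edges_on (D `|` V) | `[< exists q t y, [/\ q \in Q,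
     t \in inner_tiles Q T D, val e = [fset (q * t)%g; y]%fset
     & (y * t^-1)%g \notin Q] >]]%fset.

Lemma crossingP (G : groupType) (Q : {fset G}) (T : set G) (D V : {fset G}) e :
  reflect ((val e `<=` D `|` V)%fset /\ exists q t y, [/\ q \in Q,
     t \in inner_tiles Q T D, val e = [fset (q * t)%g; y]%fset
     & (y * t^-1)%g \notin Q]) (e \in crossing Q T D V).
Proof.
have -> : (e \in crossing Q T D V) = (e \in edges_on (D `|` V)%fset) &&
    `[< exists q t y, [/\ q \in Q, t \in inner_tiles Q T D,
        val e = [fset (q * t)%g; y]%fset & (y * t^-1)%g \notin Q] >].
  by rewrite /crossing !inE.
by rewrite in_edges_on; apply: (iffP andP) => -[h /asboolP].
Qed.

Lemma crossing_sub (G : groupType) (Q : {fset G}) (T : set G) (D V V' : {fset G}) :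
  (V `<=` V')%fset -> (crossing Q T D V `<=` crossing Q T D V')%fset.
Proof.
move=> VV'; apply/fsubsetP => e /crossingP[eV h]; apply/crossingP; split=> //.
by apply: (fsubset_trans eV); apply: fsetUS.
Qed.

Lemma ler_sum_single (R : numDomainType) (I : eqType) (r : seq I) (P : pred I)
    (f : I -> R) i :
  i \in r -> P i -> (forall i, 0 <= f i) -> f i <= \sum_(j <- r | P j) f j.
Proof.
move=> ir Pi f0; elim: r ir => // j r IH; rewrite inE big_cons.
move=> /orP[/eqP<-|/IH h]; first by rewrite Pi lerDl sumr_ge0.
by case: ifP => // _; rewrite (le_trans h) // lerDr.
Qed.

(** Write a crossing edge as [q t, y] and substitute y = g q t: its probability is
    p g, and g q lies outside Q because y lies outside the tile Q t. *)
Lemma crossing_mass (R : realType) (G : groupType) (p : G -> R)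
    (Q : {fset G}) (T : set G) (D V : {fset G}) (e : R) :
  (forall x, 0 <= p x) -> (forall x, p x = p (x^-1)%g) ->
  tiling Q T ->
  (forall L : G -> {fset G},
    \sum_(q <- Q) \sum_(g <- L q | (g * q)%g \notin Q) p g <= e * #|` Q|%:R) ->
  0 <= e ->
  \sum_(a <- crossing Q T D V) edge_prob p a <= e * #|` D|%:R.
Proof.
move=> p0 psym tQT mass e0; have /andP[ID _] := inner_tiles_card D tQT.
set I := inner_tiles Q T D in ID *; set X := crossing Q T D V.
pose W := (D `|` V)%fset.
pose h (a : edge G) t q y := if val a == [fset (q * t)%g; y]%fset
                             then p (y * (q * t)^-1)%g else 0.
have h0 a t q y : 0 <= h a t q y by rewrite /h; case: ifP.
have s1 : \sum_(a <- X) edge_prob p a <= \sum_(a <- X) \sum_(t <- I) \sum_(q <- Q)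
    \sum_(y <- W | (y * t^-1)%g \notin Q) h a t q y.
  rewrite big_seq [leRHS]big_seq; apply: ler_sum => a /crossingP[aW [q [t [y]]]].
  move=> [qQ tI aE yQ].
  have -> : edge_prob p a = h a t q y.
    by rewrite /h aE eqxx (edge_probE psym aE) psym invgM invgK.
  have yW : y \in W by apply: (fsubsetP aW); rewrite aE !inE eqxx orbT.
  apply: le_trans (ler_sum_single tI isT _) => /= [|t']; last first.
    by apply: sumr_ge0 => ? _; apply: sumr_ge0.
  apply: le_trans (ler_sum_single qQ isT _) => /= [|q']; last exact: sumr_ge0.
  exact: (@ler_sum_single _ _ _ (fun y => (y * t^-1)%g \notin Q) (h a t q) y).
apply: (le_trans s1); rewrite exchange_big /=.
apply: (@le_trans _ _ (\sum_(t <- I) \sum_(q <- Q)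
    \sum_(y <- W | (y * t^-1)%g \notin Q) p (y * (q * t)^-1)%g)).
  apply: ler_sum => t _; rewrite exchange_big /=; apply: ler_sum => q _.
  rewrite exchange_big /=; apply: ler_sum => y _.
  have [[a aX aE]|nX] := pselect (exists2 a, a \in X & val a = [fset (q * t)%g; y]%fset).
    rewrite (bigD1_seq a) //= /h aE eqxx big1 ?addr0 // => b ba.
    by rewrite -aE (inj_eq val_inj) (negPf ba).
  rewrite big_seq big1 // => a aX; rewrite /h; case: eqP => // aE.
  by case: nX; exists a.
apply: (@le_trans _ _ (\sum_(t <- I) e * #|` Q|%:R)).
  apply: ler_sum => t _.
  apply: le_trans (mass (fun q => [fset (y * (q * t)^-1)%g | y in W]%fset)).
  apply: ler_sum => q _.
  rewrite -big_filter -[leRHS]big_filter le_eqVlt; apply/orP; left; apply/eqP.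
  rewrite -(big_map (fun y => (y * (q * t)^-1)%g) xpredT p).
  apply: perm_big; apply: uniq_perm.
  - by rewrite map_inj_uniq ?filter_uniq ?fset_uniq //; exact: (@mulIg G).

  - by rewrite filter_uniq ?fset_uniq.
  move=> g; rewrite mem_filter; apply/mapP/andP => [[y]|[gQ /imfsetP[y /= yW gE]]].
    rewrite mem_filter => /andP[yQ yW] ->; split.
      by rewrite invgM mulgA mulgVK.
    by apply/imfsetP; exists y.
  exists y => //; rewrite mem_filter yW andbT.
  by move: gQ; rewrite gE invgM mulgA mulgVK.
rewrite big_const_seq iter_addr_0 count_predT -mulrnAr ler_wpM2l //.
by rewrite -mulr_natr -natrM ler_nat mulnC.
Qed.

(** Every escaping vertex is an end point of an open crossing edge, and an edge
    has only two end points.  F collects one outer end point for each escaping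
    vertex, so it depends on w. *)
Lemma escaping_card (G : groupType) (w : config G) (Q : {fset G}) (T : set G)
    (D : {fset G}) :
  exists F : {fset G}, forall V : {fset G}, (F `<=` V)%fset ->
    (#|` escaping w Q T D|
       <= 2 * \sum_(e <- crossing Q T D V) ((w : edge G -> bool) e))%N.
Proof.
set Esc := escaping w Q T D.
have /choice[y yP] : forall x, exists y, x \in Esc -> exists q t, [/\ q \in Q,
    t \in inner_tiles Q T D, x = (q * t)%g, adj w x y & (y * t^-1)%g \notin Q].
  move=> x; have [|xE] := boolP (x \in Esc); last by exists x.
  by rewrite !inE => /andP[_ /asboolP[q [t [y h]]]]; exists y => _; exists q, t.
exists [fset y x | x in Esc]%fset => V FV.
pose B := (\bigcup_(e <- crossing Q T D V | (w : edge G -> bool) e) val e)%fset.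
have EscB : (Esc `<=` B)%fset.
  apply/fsubsetP => x xE; have [q [t [qQ tI xqt xy yQ]]] := yP x xE.
  have [e eE we] := adjP xy; apply/bigfcupP; exists e; last first.
    by rewrite eE !inE eqxx.
  rewrite we andbT; apply/crossingP; split.
    rewrite eE fsubUset !fsub1set !inE; apply/andP; split.
      by move: xE; rewrite !inE => /andP[->].
    by apply/orP; right; apply: (fsubsetP FV); apply/imfsetP; exists x.
  by exists q, t, (y x); rewrite -xqt.
rewrite (leq_trans (fsubset_leq_card EscB)) // /B big_distrr /= big_mkcond /=.
elim/big_rec2: _ => [|e n C _ IH]; first by rewrite cardfs0.
rewrite (leq_trans (leq_card_fsetU _ _).1) // leq_add //.
by case: ifP => _; rewrite ?cardfs0 // (eqP (valP e)).
Qed.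

Lemma edge_pair (G : groupType) (e : edge G) : exists x y, val e = [fset x; y]%fset.
Proof.
have := valP e; rewrite -[X in is_true X -> _]/(#|` val e| == 2)%N.
case: (fset_0Vmem (val e)) => [->|[x xe]]; first by rewrite cardfs0.
rewrite (cardfsD1 x) xe eqSS => /cardfs1P[y ey]; exists x, y.
by rewrite -(fsetD1K xe) ey.
Qed.

Lemma edge_prob01 (R : realType) (G : groupType) (p : G -> R) (e : edge G) :
  (forall x, 0 <= p x <= 1) -> 0 <= edge_prob p e <= 1.
Proof. by move=> p01; exact: p01. Qed.

Lemma edge_prob_shift (R : realType) (G : groupType) (p : G -> R) t (e : edge G) :
  (forall z, p z = p (z^-1)%g) -> edge_prob p (shift_edge t e) = edge_prob p e.
Proof.
move=> psym; have [x [y exy]] := edge_pair e.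
rewrite (edge_probE psym exy) (edge_probE psym (shift_edgeE t exy)).
by rewrite invgM mulgA mulgK.
Qed.

Lemma big_indic_edges (R : realType) (G : groupType) (X : {fset edge G}) (w : config G) :
  \sum_(e : X) \1_(cylinder [fset val e]%fset (fun=> true)) w
    = (\sum_(e <- X) ((w : edge G -> bool) e))%:R :> R.
Proof.
rewrite natr_sum (big_seq_fsetE _ X xpredT (fun e => ((w : edge G -> bool) e)%:R)).
apply: eq_bigr => e _; rewrite indicE; congr (_%:R); congr nat_of_bool.
apply/idP/idP => [|we]; first by rewrite inE; apply; rewrite inE.
by rewrite inE => a; rewrite inE => /eqP->.
Qed.

(** For the finitely many crossing edges with outer end point in L n this is the
    Chernoff bound with parameter 1/2.  The bound does not depend on n, and the
    events increase with n, so it holds for their union. *)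
Lemma escaping_event (R : realType) (G : groupType) (P : {fset G}) (p : G -> R)
    (mu : probability (config G) R) (Q : {fset G}) (T : set G) (D : {fset G}) (e : R) :
  generates P -> (forall x, 0 <= p x <= 1) -> (forall x, p x = p (x^-1)%g) ->
  percolation_measure p mu -> tiling Q T ->
  (forall L : G -> {fset G},
    \sum_(q <- Q) \sum_(g <- L q | (g * q)%g \notin Q) p g <= e * #|` Q|%:R) ->
  0 <= e ->
  exists B : set (config G), [/\ measurable B,
    (mu B <= (expR (- e * #|` D|%:R))%:E)%E &
    forall w, ~ B w -> #|` escaping w Q T D|%:R <= 8 * e * #|` D|%:R].
Proof.
move=> genP p01 psym mu_perc tQT mass e0.
have p0 x : 0 <= p x by have /andP[] := p01 x.
have [L [Lmono Lcof]] := exhaustion genP.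
pose X n := crossing Q T D (L n).
(* Twice the threshold 4 e |D| for open edges is the bound on vertices. *)
pose k := 4 * e * #|` D|%:R.
pose A n : set (config G) := [set w | 2^-1 * k <= 2^-1 *
  \sum_(a : X n) \1_(cylinder [fset val a]%fset (fun=> true)) w].
have chern n : measurable (A n) /\ (mu (A n) <= (expR (- e * #|` D|%:R))%:E)%E.
  have disj (a b : X n) : a != b -> [disjoint [fset val a] & [fset val b]]%fset.
    by move=> ab; rewrite fdisjoint1X in_fset1; apply: contra ab => /eqP/val_inj->.
  have := @indep_chernoff _ _ R mu (X n)
    (fun a => cylinder [fset val a]%fset (fun=> true))
    (fun a => edge_prob p (val a)) 2^-1 k.
  case.
  - by move=> a; exact: measurable_cylinder.
  - by move=> a; exact: edge_prob01.
  - move=> J; rewrite (cylinder_indep (fun=> (fun=> true)) J mu_perc disj).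
    by congr (_%:E); apply: eq_bigr => a _; rewrite big_seq_fset1.
  - exact: lexx.
  move=> mA muA; split; first exact: mA.
  apply: (le_trans muA); rewrite lee_fin ler_expR.
  have := crossing_mass D (L n) p0 psym tQT mass e0.
  rewrite -/(X n) (big_seq_fsetE _ (X n) xpredT (edge_prob p)) /= /k.
  by set s := \sum_(_ | _) _; nra.
exists (\bigcup_n A n); split.
- by apply: bigcup_measurable => n _; exact: (chern n).1.
- apply: measure_bigcup_le => [n|m n mn|n]; [exact: (chern n).1| |exact: (chern n).2].
  apply/subsetPset => w; rewrite /A /= !big_indic_edges => h; apply: (le_trans h).
  rewrite ler_wpM2l // ler_nat.
  have XX := crossing_sub Q T D (Lmono _ _ mn); rewrite -/(X m) -/(X n) in XX.
  rewrite [leqRHS](bigID (mem (X m))) /= (leq_trans _ (leq_addr _ _)) //.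
  rewrite -[leqRHS]big_filter; apply: eq_leq; apply: perm_big; apply: uniq_perm.
  - exact: fset_uniq.
  - by rewrite filter_uniq ?fset_uniq.
  move=> a; rewrite mem_filter /=; have [aX|//] := boolP (a \in X m).
  by rewrite (fsubsetP XX).
move=> w nB; have [F FP] := escaping_card w Q T D; have [n Fn] := Lcof F.
have := FP _ Fn; rewrite -(ler_nat R) => /le_trans; apply.
have : ~ A n w by move=> Anw; apply: nB; exists n.
rewrite /A /= big_indic_edges -/(X n) natrM => /negP; rewrite -ltNge /k.
by set s := _%:R; set d := (#|` D|)%:R; lra.
Qed.

(** * Pattern frequencies *)

Lemma window_cylinder (G : groupType) (w : config G) (Q : {fset G}) t (S : subgraph G) :
  vertices S = Q ->
  window w Q t = S <->
  cylinder [fset shift_edge t e | e in edges_on Q]%fset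
    (fun e' => e' \in [fset shift_edge t e | e in edges S]%fset) w.
Proof.
move=> SQ; have SE e : e \in edges S -> (val e `<=` Q)%fset.
  by move=> eS; rewrite -SQ; apply: (allP (valP S)).
have mem_shift (X : {fset edge G}) e :
    (shift_edge t e \in [fset shift_edge t a | a in X]%fset) = (e \in X).
  by apply/imfsetP/idP => [[a /= aX /shift_edge_inj->//]|eX]; exists e.
split=> [wS e' /imfsetP[e /= eQ ->]|h].
  by rewrite mem_shift -wS in_edges_window -in_edges_on eQ.
apply: val_inj; rewrite [LHS]surjective_pairing [RHS]surjective_pairing.
congr pair; first by rewrite -[RHS]/(vertices S) SQ.
apply/fsetP => e; rewrite -[LHS]/(e \in edges (window w Q t)) in_edges_window.
rewrite -[RHS]/(e \in edges S) -mem_shift.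
apply/andP/idP => [[eQ we]|eS].
  by rewrite -h //; apply/imfsetP; exists e => //=; rewrite in_edges_on.
have eQ : (val e `<=` Q)%fset by apply: SE; rewrite -mem_shift.
by rewrite h //; apply/imfsetP; exists e => //=; rewrite in_edges_on.
Qed.

(** The frequency nu_S is the probability of the cylinder that prescribes the
    state of all edges inside the vertex set of S. *)
Lemma nuE (R : realType) (G : groupType) (p : G -> R) (S : subgraph G) :
  nu p S = \prod_(e <- edges_on (vertices S))
             (if e \in edges S then edge_prob p e else 1 - edge_prob p e).
Proof.
set Q := vertices S.
have SE e : e \in edges S -> e \in edges_on Q.
  by move=> eS; rewrite in_edges_on; apply: (allP (valP S)).
rewrite /nu (fsbig_fwiden [seq e <- edges_on Q | e \notin edges S]); last 3 first.
- by move=> e [eQ eS] /=; rewrite mem_filter eS in_edges_on.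
- by rewrite filter_uniq ?fset_uniq.
- move=> e [/=]; rewrite mem_filter in_edges_on => /andP[eS eQ] h.
  by exfalso; apply: h.
rewrite [RHS](bigID (mem (edges S))) /=; congr (_ * _); last first.
  by rewrite big_filter; apply: eq_bigr => e /negPf->.
rewrite -[RHS]big_filter (perm_big [seq e <- edges_on Q | e \in edges S]).
  by rewrite !big_filter; apply: eq_bigr => e ->.
apply: uniq_perm; rewrite ?fset_uniq ?filter_uniq ?fset_uniq // => e.
by rewrite mem_filter /=; case: (boolP (e \in edges S)) => // /SE->.
Qed.

Lemma nu_01 (R : realType) (G : groupType) (p : G -> R) (S : subgraph G) :
  (forall x, 0 <= p x <= 1) -> 0 <= nu p S <= 1.
Proof.
move=> p01; rewrite nuE.
have f01 e : 0 <= (if e \in edges S then edge_prob p e else 1 - edge_prob p e) <= 1.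
  by have := edge_prob01 e p01; case: ifP => _ //; lra.
rewrite prodr_ge0 /= => [|e _]; last by have /andP[] := f01 e.
by apply: prodr_ile1 => e _; exact: f01.
Qed.

(** The signs s = 1 and s = -1 give the two tails; the Chernoff parameter l = s d / 4
    minimizes the exponent 2 l^2 - s l d. *)
Lemma frequency_event (R : realType) (G : groupType) (p : G -> R)
    (mu : probability (config G) R) (Q : {fset G}) (T : set G) (D : {fset G})
    (S : subgraph G) (d s : R) :
  (forall x, 0 <= p x <= 1) -> (forall x, p x = p (x^-1)%g) ->
  percolation_measure p mu -> tiling Q T -> vertices S = Q -> 0 < d <= 2 ->
  s = 1 \/ s = -1 ->
  exists B : set (config G), [/\ measurable B,
    (mu B <= (expR (- (d ^+ 2 / 8) * #|` D|%:R))%:E)%E &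
    forall w, ~ B w ->
      s * (\sum_(t <- inner_tiles Q T D) (window w Q t == S)%:R
           - #|` inner_tiles Q T D|%:R * nu p S) <= d * #|` D|%:R].
Proof.
move=> p01 psym mu_perc tQT SQ d02 s1.
have /andP[leID _] := inner_tiles_card D tQT.
set I := inner_tiles Q T D in leID *.
have [Q0 _ Tuniq] := tQT.
pose A (t : I) := [fset shift_edge (val t) e | e in edges_on Q]%fset.
pose c (t : I) (e' : edge G) := e' \in [fset shift_edge (val t) e | e in edges S]%fset.
have disj (t u : I) : t != u -> [disjoint A t & A u]%fset.
  move=> tu; apply/fdisjointP => _ /imfsetP[e /= eQ ->]; apply: contra tu.
  move=> /imfsetP[e' /= eQ' /(congr1 val)]; have [x [y exy]] := edge_pair e.
  move=> ee'; have : (x * val t)%g \in val (shift_edge (val t) e).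
    by rewrite (shift_edgeE _ exy) !inE eqxx.
  rewrite ee' => /imfsetP[z /= ze' xz]; apply/eqP/val_inj.
  rewrite !in_edges_on in eQ eQ'.
  have /(inner_tilesP _ _ _ Q0)[Tt _] := valP t.
  have /(inner_tilesP _ _ _ Q0)[Tu _] := valP u.
  have xQ : x \in Q by apply: (fsubsetP eQ); rewrite exy !inE eqxx.
  by have [_ ->] := Tuniq _ _ _ _ xQ Tt (fsubsetP eQ' _ ze') Tu xz.
have prob (t : I) : \prod_(e <- A t)
    (if c t e then edge_prob p e else 1 - edge_prob p e) = nu p S.
  rewrite big_imfset /=; last by move=> e e' _ _; exact: shift_edge_inj.
  rewrite nuE SQ; apply: eq_bigr => e _; rewrite edge_prob_shift // /c.
  suff -> : (shift_edge (val t) e \in [fset shift_edge (val t) a | a in edges S]%fset)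
      = (e \in edges S) by [].
  by apply/imfsetP/idP => [[a /= aX /shift_edge_inj->//]|eX]; exists e.
pose l := s * (d / 4); pose k := #|` I|%:R * nu p S + s * d * #|` D|%:R.
have nu01 := nu_01 S p01.
have := @indep_chernoff _ _ R mu I (fun t => cylinder (A t) (c t)) (fun=> nu p S) l k.
case.
- by move=> t; exact: measurable_cylinder.
- by move=> _.
- move=> J; rewrite (cylinder_indep c J mu_perc disj).
  by congr (_%:E); apply: eq_bigr => t _; exact: prob.
- by rewrite /l; case: s1 => ->; lra.
move=> mB muB.
exists [set w | l * k <= l * \sum_t \1_(cylinder (A t) (c t)) w]; split.
- exact: mB.
- apply: (le_trans muB); rewrite lee_fin ler_expR sumr_const -cardfE -[nu p S *+ _]mulr_natl.
  have ID : #|` I|%:R <= #|` D|%:R :> R.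
    by rewrite ler_nat (leq_trans _ leID) // leq_pmulr // cardfs_gt0.
  have nID : #|` I|%:R * nu p S <= #|` D|%:R.
    apply: le_trans ID; rewrite ler_piMr //; lra.
  rewrite /l /k; set n := _ * nu p S in nID *; set D' := #|` D|%:R in nID *.
  have -> : (s * (d / 4) + 2 * (s * (d / 4)) ^+ 2) * n
      - s * (d / 4) * (n + s * d * D') = s ^+ 2 * (d ^+ 2 / 4) * (n / 2 - D') by field.
  have -> : s ^+ 2 = 1 by case: s1 => ->; rewrite ?expr1n ?sqrrN ?expr1n.
  rewrite mul1r.
  have : 0 <= d ^+ 2 / 4 by rewrite divr_ge0 ?sqr_ge0.
  nra.
move=> w /= /negP; rewrite -ltNge.
have -> : \sum_t \1_(cylinder (A t) (c t)) w
    = \sum_(t <- I) (window w Q t == S)%:R :> R.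
  rewrite (big_seq_fsetE _ I xpredT (fun t => (window w Q t == S)%:R)) /=.
  apply: eq_bigr => t _; rewrite indicE; congr (_%:R); congr nat_of_bool.
  by apply/idP/eqP => [|/window_cylinder h]; [rewrite inE => h; apply/window_cylinder|rewrite inE; apply: h].
rewrite /l /k; set X := \sum_(_ <- _) _; set n := _ * nu p S; set D' := #|` D|%:R.
have /andP[d0 _] := d02; have d4 : 0 < d / 4 by rewrite divr_gt0.
have -> : s * (d / 4) * X = d / 4 * (s * X) by ring.
have -> : s * (d / 4) * (n + s * d * D') = d / 4 * (s * n + s ^+ 2 * (d * D')) by ring.
have -> : s ^+ 2 = 1 by case: s1 => ->; rewrite ?expr1n ?sqrrN ?expr1n.
rewrite (ltr_pM2l d4); lra.
Qed.

(** * Almost sure approximation of the eigenvalue count *)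

Lemma subgraphs_on_finite (G : groupType) (Q : {fset G}) :
  finite_set (@subgraphs_on G Q).
Proof.
pose subs : seq (subgraph G) :=
  pmap insub [seq (Q, X) | X <- enum_fset (fpowerset (edges_on Q))].
apply: (@sub_finite_set _ _ [set` subs]); last exact: finite_seq.
move=> S SQ /=; rewrite mem_pmap_sub; apply/mapP; exists (edges S).
  rewrite fpowersetE; apply/fsubsetP => e eS; rewrite in_edges_on.
  by rewrite -[Q]SQ; apply: (allP (valP S)).
by rewrite -[in RHS]SQ [LHS]surjective_pairing.
Qed.

Lemma Ftilde_count_le (R : realType) (G : groupType) (S : subgraph G) (E : R) :
  (Ftilde_count S E <= #|` vertices S|)%N.
Proof. by apply: eigen_count_le_dim; exact: laplacian_sym. Qed.

Lemma strictly_increasing_ge (G : groupType) (Q : nat -> {fset G}) n :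
  strictly_increasing Q -> (n <= #|` Q n|)%N.
Proof. by move=> h; elim: n => // n IH; exact: leq_ltn_trans IH (h n). Qed.

(** Borel-Cantelli: a strictly increasing sequence of sizes satisfies
    |Q n| >= n, so that the probabilities decay geometrically. *)
Lemma ae_of_events (R : realType) (G : groupType) (mu : probability (config G) R)
    (Q : nat -> {fset G}) (A : nat -> config G -> Prop) (r : R) :
  strictly_increasing Q -> 0 < r ->
  (forall n, exists B : set (config G), [/\ measurable B,
     (mu B <= (expR (- r * #|` Q n|%:R))%:E)%E & forall w, ~ B w -> A n w]) ->
  {ae mu, forall w, \forall n \near \oo, A n w}.
Proof.
move=> Qincr r0 /choice[B /all_and3[mB muB BA]].
have := @ae_eventually_not _ _ R mu B r r0 mB.
have muB' n : (mu (B n) <= (expR (- r * n%:R))%:E)%E.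
  apply: (le_trans (muB n)); rewrite lee_fin ler_expR !mulNr lerN2.
  by rewrite ler_wpM2l ?(ltW r0) // ler_nat strictly_increasing_ge.
move=> /(_ muB'); apply: filterS => w; apply: filterS => n; exact: BA.
Qed.

Lemma sum_windows (R : realType) (G : groupType) (w : config G) (Q : {fset G})
    (I : {fset G}) (f : subgraph G -> R) :
  \sum_(t <- I) f (window w Q t) =
  \sum_(S <- fset_set (@subgraphs_on G Q))
     (\sum_(t <- I) (window w Q t == S)%:R) * f S.
Proof.
under [RHS]eq_bigr do rewrite mulr_suml.
rewrite exchange_big; apply: eq_bigr => t _ /=.
rewrite (bigD1_seq (window w Q t)) ?fset_uniq //=; last first.
  by rewrite in_fset_set ?inE //; exact: subgraphs_on_finite.
rewrite eqxx mul1r big1 ?addr0 // => S; rewrite eq_sym => /negPf->.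
by rewrite mul0r.
Qed.

(** Three errors add up: the cut along the tiles, the deviation of the empirical
    frequencies from the nu_S, and the part of D covered by no inner tile. *)
Lemma F_count_estimate (R : realType) (G : groupType) (p : G -> R) (w : config G)
    (Q : {fset G}) (T : set G) (D : {fset G}) (a d h E : R) :
  (forall x, 0 <= p x <= 1) -> tiling Q T ->
  let I := inner_tiles Q T D in
  let Ss := fset_set (@subgraphs_on G Q) in
  #|` escaping w Q T D|%:R <= 8 * a * #|` D|%:R ->
  (forall S, S \in Ss ->
     `|\sum_(t <- I) (window w Q t == S)%:R - #|` I|%:R * nu p S| <= d * #|` D|%:R) ->
  #|` D|%:R - #|` I|%:R * #|` Q|%:R <= h * #|` D|%:R ->
  #|` Ss|%:R * (d * #|` Q|%:R) <= a -> h * (1 + \sum_(S <- Ss) nu p S) <= a ->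
  `|(F_count w D E)%:R
    - #|` D|%:R * \sum_(S <- Ss) nu p S * ((Ftilde_count S E)%:R / #|` Q|%:R)|
  <= 10 * a * #|` D|%:R.
Proof.
move=> p01 tQT I Ss esc freq left da ha.
have cut_error (f x u n v : R) : x <= f + u -> f + v <= x + n + u ->
    u <= 8 * a * n -> n - v <= h * n -> v <= n -> `|f - x| <= 8 * a * n + h * n.
  by clear=> h1 h2 h3 h4 h5; rewrite ler_norml; apply/andP; split; lra.
have total_error (x y z u v n b : R) : z <= x + y -> x <= 8 * a * n + h * n ->
    y <= a * n -> u <= h * n * b -> h * n * (1 + b) <= a * n ->
    z + u <= 10 * a * n.
  by clear=> h1 h2 h3 h4 h5; lra.
have [Q0 _ _] := tQT; have cQ : 0 < #|` Q|%:R :> R by rewrite ltr0n cardfs_gt0.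
have /andP[leID _] := inner_tiles_card D tQT.
have ID : #|` I|%:R * #|` Q|%:R <= #|` D|%:R :> R.
  by rewrite -natrM ler_nat.
have SsQ S : S \in Ss -> vertices S = Q.
  by rewrite in_fset_set ?inE //; exact: subgraphs_on_finite.
have [low upp] := F_count_tiles w D E tQT; rewrite -/I in low upp.
set esc' := #|` escaping _ _ _ _| in esc low upp.
set F := F_count _ _ _ in low upp *.
pose X := (\sum_(t <- I) Ftilde_count (window w Q t) E)%N.
rewrite -/X -(ler_nat R) natrD in low.
rewrite -/X -(ler_nat R) !natrD natrM in upp.
pose N : R := #|` D|%:R; pose m : R := #|` Q|%:R; pose nI : R := #|` I|%:R.
have XE : X%:R = \sum_(S <- Ss) (\sum_(t <- I) (window w Q t == S)%:R)
                   * (Ftilde_count S E)%:R :> R.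
  by rewrite natr_sum (sum_windows w Q I (fun S => (Ftilde_count S E)%:R)).
have nu0 S : 0 <= nu p S by have /andP[] := nu_01 S p01.
pose A := \sum_(S <- Ss) nu p S * ((Ftilde_count S E)%:R / m).
have XA : `|X%:R - nI * (m * A)| <= a * N.
  have -> : X%:R - nI * (m * A) = \sum_(S <- Ss)
      (\sum_(t <- I) (window w Q t == S)%:R - nI * nu p S) * (Ftilde_count S E)%:R.
    rewrite XE /A !mulr_sumr -sumrB; apply: eq_bigr => S _.
    rewrite mulrBl; congr (_ - _); rewrite /m; field.
    by rewrite gt_eqF.
  apply: (le_trans (ler_norm_sum _ _ _)).
  apply: (@le_trans _ _ (\sum_(S <- Ss) d * N * m)).
    rewrite big_seq [leRHS]big_seq; apply: ler_sum => S SS.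
    rewrite normrM normr_nat ler_pM // ?freq // ler_nat -(SsQ S SS).
    exact: Ftilde_count_le.
  rewrite big_const_seq iter_addr_0 count_predT -mulr_natr -[size _]/(#|` Ss|).
  rewrite -[leRHS]/(a * N).
  have -> : d * N * m * #|` Ss|%:R = #|` Ss|%:R * (d * m) * N by ring.
  by apply: ler_wpM2r => //; exact: ler0n.
have A0 : 0 <= A.
  by apply: sumr_ge0 => S _; rewrite mulr_ge0 // divr_ge0 // ler0n.
have Ac : A <= \sum_(S <- Ss) nu p S.
  rewrite /A big_seq [leRHS]big_seq; apply: ler_sum => S SS; rewrite ler_piMr //.
  by rewrite ler_pdivrMr // mul1r ler_nat -(SsQ S SS) Ftilde_count_le.
have N0 : 0 <= N by exact: ler0n.
rewrite -/N -/m -/A in esc left ID upp ha *.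
rewrite -/nI in upp left ID.
set c := \sum_(S <- Ss) nu p S in Ac ha.
set r := N - nI * m in left.
have r0 : 0 <= r by rewrite subr_ge0.
have rA : r * A <= h * N * c by apply: ler_pM.
have hN : h * N * (1 + c) <= a * N.
  by rewrite mulrAC ler_wpM2r.
have FX : `|F%:R - X%:R| <= 8 * a * N + h * N.
  exact: cut_error low upp esc left ID.
have -> : F%:R - N * A = (F%:R - X%:R) + (X%:R - nI * (m * A)) - r * A.
  by rewrite /r; ring.
apply: (le_trans (ler_normB _ _)); rewrite (ger0_norm (mulr_ge0 r0 A0)).
have := ler_normD (F%:R - X%:R) (X%:R - nI * (m * A)).
by move=> le3; apply: total_error le3 FX XA rA hN.
Qed.

(** The tolerances d for the frequencies and h for the uncovered part of D j are
    chosen small depending on the fixed tile Q, whereas the escaping vertices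
    cost a proportion of order a, the quality of that tile. *)
Lemma ae_count_estimate (R : realType) (G : groupType) (P : {fset G}) (p : G -> R)
    (mu : probability (config G) R) (Q : {fset G}) (T : set G)
    (D : nat -> {fset G}) (a : R) :
  generates P -> (forall x, 0 <= p x <= 1) -> (forall x, p x = p (x^-1)%g) ->
  percolation_measure p mu -> folner R D -> strictly_increasing D ->
  tiling Q T -> 0 < a ->
  (forall L : G -> {fset G},
    \sum_(q <- Q) \sum_(g <- L q | (g * q)%g \notin Q) p g <= a * #|` Q|%:R) ->
  {ae mu, forall w, \forall j \near \oo, forall E : R,
    `|(F_count w (D j) E)%:R / #|` D j|%:R
      - \sum_(S \in @subgraphs_on G Q) nu p S * ((Ftilde_count S E)%:R / #|` Q|%:R)|
    <= 10 * a}.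
Proof.
move=> genP p01 psym mu_perc [D0 Dfol] Dincr tQT a0 mass.
have [Q0 _ _] := tQT; have cQ : 0 < #|` Q|%:R :> R by rewrite ltr0n cardfs_gt0.
set Ss := fset_set (@subgraphs_on G Q).
have SsQ S : S \in Ss -> vertices S = Q.
  by rewrite in_fset_set ?inE //; exact: subgraphs_on_finite.
pose c := \sum_(S <- Ss) nu p S.
have c0 : 0 <= c.
  by apply: sumr_ge0 => S _; have /andP[] := nu_01 S p01.
pose h := a / (1 + c); have h0 : 0 < h by rewrite divr_gt0 // ltr_pwDl.
pose M := 1 + #|` Ss|%:R * #|` Q|%:R : R.
have M0 : 0 < M by rewrite ltr_pwDl // mulr_ge0.
pose d := Num.min 2 (a / M).
have d0 : 0 < d by rewrite lt_min divr_gt0 // ltr0n.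
have d2 : d <= 2 by rewrite ge_min lexx.
have dM : d * M <= a by rewrite -ler_pdivlMr // ge_min lexx orbT.
have da : #|` Ss|%:R * (d * #|` Q|%:R) <= a.
  by apply: le_trans dM; rewrite /M mulrDr mulr1 mulrCA lerDr ltW.
have leftover : \forall j \near \oo, #|` D j|%:R
    - #|` inner_tiles Q T (D j)|%:R * #|` Q|%:R <= h * #|` D j|%:R.
  pose K := [fset (q * q'^-1)%g | q in Q, q' in Q]%fset.
  have hQ : 0 < h / #|` Q|%:R ^+ 2 by rewrite divr_gt0 // exprn_gt0.
  have /cvgrPdist_le /(_ _ hQ) := Dfol K; apply: filterS => j.
  rewrite sub0r normrN ger0_norm ?divr_ge0 // ler_pdivrMr ?ltr0n ?cardfs_gt0 //.
  move=> bd; have /andP[_] := inner_tiles_card (D j) tQT.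
  rewrite -(ler_nat R) natrD !natrM -/K => le1.
  rewrite lerBlDl (le_trans le1) // lerD2l //.
  have Q2 : 0 < #|` Q|%:R ^+ 2 :> R by rewrite exprn_gt0.
  rewrite -expr2 (le_trans (ler_wpM2l (ltW Q2) bd)) //.
  by rewrite mulrA mulrCA divff ?mulr1 // gt_eqF.
have aeEsc : {ae mu, forall w, \forall j \near \oo,
    #|` escaping w Q T (D j)|%:R <= 8 * a * #|` D j|%:R}.
  apply: (@ae_of_events _ _ mu D _ a Dincr a0) => n.
  exact: (escaping_event (D n) genP p01 psym mu_perc tQT mass (ltW a0)).
have aeFreq s S : S \in Ss -> s = 1 \/ s = -1 ->
    {ae mu, forall w, \forall j \near \oo,
      s * (\sum_(t <- inner_tiles Q T (D j)) (window w Q t == S)%:R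
           - #|` inner_tiles Q T (D j)|%:R * nu p S) <= d * #|` D j|%:R}.
  move=> /SsQ SQ s1.
  have d8 : 0 < d ^+ 2 / 8 by rewrite divr_gt0 // exprn_gt0.
  apply: (@ae_of_events _ _ mu D _ _ Dincr d8) => n.
  by apply: (frequency_event _ p01 psym mu_perc tQT SQ) => //; rewrite d0.
have aeAll : {ae mu, forall w, forall S, S \in Ss -> \forall j \near \oo,
    `|\sum_(t <- inner_tiles Q T (D j)) (window w Q t == S)%:R
       - #|` inner_tiles Q T (D j)|%:R * nu p S| <= d * #|` D j|%:R}.
  have aeS (S : Ss) : {ae mu, forall w, \forall j \near \oo,
    `|\sum_(t <- inner_tiles Q T (D j)) (window w Q t == val S)%:R
       - #|` inner_tiles Q T (D j)|%:R * nu p (val S)| <= d * #|` D j|%:R}.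
    have := aeFreq _ _ (valP S) (or_introl (erefl 1)).
    have := aeFreq _ _ (valP S) (or_intror (erefl (-1))).
    apply: filterS2 => w; apply: filterS2 => j.
    by rewrite mulN1r mul1r ler_norml lerNl => -> ->.
  have : {ae mu, forall w, forall S : Ss, \forall j \near \oo,
    `|\sum_(t <- inner_tiles Q T (D j)) (window w Q t == val S)%:R
       - #|` inner_tiles Q T (D j)|%:R * nu p (val S)| <= d * #|` D j|%:R}.
    by apply: filter_forall; exact: aeS.
  apply: filterS => w wS S SS.
  exact: (wS (FSetSub SS)).
move: aeEsc aeAll; apply: filterS2 => w wEsc wAll.
have wAll' : \forall j \near \oo, forall S : Ss,
    `|\sum_(t <- inner_tiles Q T (D j)) (window w Q t == val S)%:R
       - #|` inner_tiles Q T (D j)|%:R * nu p (val S)| <= d * #|` D j|%:R.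
  by apply: filter_forall => S; apply: wAll; exact: valP.
near=> j => E.
have Dj : 0 < #|` D j|%:R :> R by rewrite ltr0n cardfs_gt0.
have est : `|(F_count w (D j) E)%:R
    - #|` D j|%:R * \sum_(S <- Ss) nu p S * ((Ftilde_count S E)%:R / #|` Q|%:R)|
  <= 10 * a * #|` D j|%:R.
  apply: (@F_count_estimate _ _ p w Q T (D j) a d h E p01 tQT) => //.
  - by near: j.
  - move=> S SS; have : forall S : Ss,
      `|\sum_(t <- inner_tiles Q T (D j)) (window w Q t == val S)%:R
       - #|` inner_tiles Q T (D j)|%:R * nu p (val S)| <= d * #|` D j|%:R.
      by near: j.
    by move=> /(_ (FSetSub SS)).
  - by near: j.
  - by rewrite /h -/c divfK // gt_eqF // ltr_pwDl.
rewrite fsbig_finite; last exact: subgraphs_on_finite.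
rewrite -(ler_pM2r Dj) -[X in _ * X <= _](ger0_norm (ltW Dj)) -normrM mulrBl.
by rewrite divfK ?gt_eqF // (mulrC (\sum_(_ <- _) _)).
Unshelve. all: by end_near.
Qed.

(** * Uniform convergence *)

Lemma BR_bounded (R : realType) (f : R -> R) (B : R) :
  (forall x, `|f x| <= B) -> right_continuous f -> BR f.
Proof.
move=> fB fr; split=> //; exists B; split; first exact: num_real.
by move=> M BM x _ /=; apply: (le_trans (fB x)); exact: ltW.
Qed.

Lemma BR_bound (R : realType) (f : R -> R) : BR f -> exists B, forall x, `|f x| <= B.
Proof.
move=> [[B [_ fB]] _]; exists (B + 1) => x.
by apply: (fB (B + 1) _ x) => //; rewrite ltrDl.
Qed.

Lemma BR_sum (R : realType) (I : Type) (r : seq I) (f : I -> R -> R) :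
  (forall i, BR (f i)) -> BR (fun x => \sum_(i <- r) f i x).
Proof.
move=> fBR; elim: r => [|i r IH].
  apply: (@BR_bounded _ _ 0) => [x|x]; first by rewrite big_nil normr0.
  by under eq_fun do rewrite big_nil; rewrite big_nil; exact: cvg_cst.
have [[B1 fB1] [B2 fB2]] := (BR_bound (fBR i), BR_bound IH).
apply: (@BR_bounded _ _ (B1 + B2)) => [x|x].
  by rewrite big_cons (le_trans (ler_normD _ _)) // lerD.
under eq_fun do rewrite big_cons; rewrite big_cons.
by apply: cvgD; [exact: (fBR i).2|exact: IH.2].
Qed.

Lemma BR_scale (R : realType) (c : R) (f : R -> R) : BR f -> BR (fun x => c * f x).
Proof.
move=> fBR; have [B fB] := BR_bound fBR; apply: (@BR_bounded _ _ (`|c| * B)) => [x|x].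
  by rewrite normrM ler_wpM2l.
by apply: cvgM; [exact: cvg_cst|exact: fBR.2].
Qed.

Lemma BR_eigen_count (R : realType) n (A : 'M[R]_n) :
  A^T = A -> BR (fun E => (eigen_count A E)%:R : R).
Proof.
move=> symA; apply: (@BR_bounded _ _ n%:R); last exact: eigen_count_right_continuous.
by move=> E; rewrite normr_nat ler_nat eigen_count_le_dim.
Qed.

Lemma BR_uniform_limit (R : realType) (u : nat -> R -> R) (N : R -> R) :
  (forall n, BR (u n)) ->
  (forall e, 0 < e -> \forall n \near \oo, forall x, `|u n x - N x| <= e) ->
  BR N.
Proof.
move=> uBR uN.
have [n _ /(_ n (leqnn n)) n1] := uN _ ltr01; have [B uB] := BR_bound (uBR n).
apply: (@BR_bounded _ _ (B + 1)) => [x|x].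
  rewrite -(subrK (u n x) (N x)) addrC (le_trans (ler_normD _ _)) // lerD //.
  by rewrite distrC.
apply/cvgrPdist_le => e e0.
have e3 : 0 < e / 3 by rewrite divr_gt0.
have [m _ /(_ m (leqnn m)) me] := uN _ e3.
have /cvgrPdist_le /(_ _ e3) := (uBR m).2 x; apply: filterS => y xy.
have -> : N x - N y = - (u m x - N x) + (u m x - u m y) + (u m y - N y) by ring.
apply: (le_trans (ler_normD _ _)).
have := ler_normD (- (u m x - N x)) (u m x - u m y); rewrite normrN.
by have := me x; have := me y; lra.
Qed.

Lemma cvg_BR_uniform (R : realType) (u : nat -> R -> R) (N : R -> R) :
  (forall n, BR (u n)) ->
  (forall e, 0 < e -> \forall n \near \oo, forall x, `|u n x - N x| <= e) ->
  cvg_BR u N.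
Proof.
move=> uBR uN; split=> //; first exact: BR_uniform_limit uN.
apply/cvgrPdist_le => e e0; apply: filterS (uN e e0) => n ne.
rewrite sub0r normrN /supnorm.
set S := (X in sup X).
have S0 : S !=set0 by exists `|(u n \- N) 0|; exists 0.
have Se : ubound S e by move=> _ [x _ <-]; exact: ne.
rewrite ger0_norm; first exact: ge_sup.
have : S `|(u n \- N) 0| by exists 0.
by move=> /(ub_le_sup (ex_intro _ e Se)); apply: le_trans.
Qed.

(** A single w outside the null set shows that A is uniformly Cauchy; its limit N
    is deterministic, and by the triangle inequality every w outside the null
    set has the same limit. *)
Lemma uniform_limit_of_approximants (R : realType) (d : measure_display)
    (T : measurableType d) (mu : probability T R)
    (f : T -> nat -> R -> R) (A : nat -> R -> R) :
  (forall e, 0 < e -> \forall M \near \oo, {ae mu, forall w,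
     \forall j \near \oo, forall E, `|f w j E - A M E| <= e}) ->
  exists N : R -> R,
    (forall e, 0 < e -> \forall M \near \oo, forall E, `|A M E - N E| <= e) /\
    {ae mu, forall w, forall e, 0 < e -> \forall j \near \oo, forall E,
      `|f w j E - N E| <= e}.
Proof.
move=> H; pose e (k : nat) : R := k.+1%:R^-1.
have e0 k : 0 < e k by rewrite invr_gt0.
have esmall x : 0 < x -> exists k, 3 * e k <= x.
  move=> x0; have [k _ /(_ k (leqnn k))] := near_infty_natSinv_lt (PosNum (divr_gt0 x0 (ltr0n R 3))).
  by rewrite /= -/(e k) => /ltW kx; exists k; lra.
have /choice[m mP] : forall k, exists m, forall M, (m <= M)%N ->
    {ae mu, forall w, \forall j \near \oo, forall E, `|f w j E - A M E| <= e k}.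
  by move=> k; have [m _ mP] := H _ (e0 k); exists m.
have aeAll : {ae mu, forall w, forall k M, (m k <= M)%N ->
    \forall j \near \oo, forall E, `|f w j E - A M E| <= e k}.
  apply: ae_foralln => k; apply: ae_foralln => M.
  have [kM|kM] := leqP (m k) M; first by apply: filterS (mP k M kM) => w h _.
  by apply: nearW => w.
have [w0 w0P] : exists w, forall k M, (m k <= M)%N ->
    \forall j \near \oo, forall E, `|f w j E - A M E| <= e k.
  have mu0 : (0 < mu [set: T])%E by rewrite probability_setT.
  have := ae_properfilter_algebraOfSetsType mu0 => PF.
  exact: (@filter_ex _ _ PF _ aeAll).
have cauchyA k M M' E : (m k <= M)%N -> (m k <= M')%N ->
    `|A M E - A M' E| <= 2 * e k.
  move=> kM kM'; have [j [h1 h2]] := filter_ex (filterI (w0P k M kM) (w0P k M' kM')).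
  have -> : A M E - A M' E = - (f w0 j E - A M E) + (f w0 j E - A M' E) by ring.
  rewrite (le_trans (ler_normD _ _)) // normrN.
  by have := h1 E; have := h2 E; lra.
pose N E := lim (A n E @[n --> \oo]).
have AN E : A n E @[n --> \oo] --> N E.
  apply: cauchy_cvg; apply: cauchy_exP => x x0; have [k kx] := esmall x x0.
  exists (A (m k) E); exists (m k) => // M /= kM.
  rewrite /ball /=; apply: le_lt_trans (cauchyA k (m k) M E (leqnn _) kM) _.
  by have := e0 k; lra.
have ANk k M E : (m k <= M)%N -> `|A M E - N E| <= 2 * e k.
  move=> kM; apply/ler_addgt0Pr => x x0.
  have /cvgrPdist_le /(_ _ x0) [n _ nP] := AN E.
  pose M' := maxn n (m k).
  have -> : A M E - N E = (A M E - A M' E) - (N E - A M' E) by ring.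
  rewrite (le_trans (ler_normB _ _)) // lerD //.
    by apply: cauchyA => //; rewrite leq_maxr.
  by apply: nP; rewrite /= leq_maxl.
exists N; split.
  move=> x x0; have [k kx] := esmall x x0; exists (m k) => // M /= kM E.
  by apply: (le_trans (ANk k M E kM)); have := e0 k; lra.
apply: filterS aeAll => w wP x x0; have [k kx] := esmall x x0.
apply: filterS (wP k (m k) (leqnn _)) => j jE E.
have -> : f w j E - N E = (f w j E - A (m k) E) + (A (m k) E - N E) by ring.
rewrite (le_trans (ler_normD _ _)) //.
by have := jE E; have := ANk k (m k) E (leqnn _); lra.
Qed.

Theorem theorem5p3 (R : realType) (G : groupType) (P : {fset G})
    (Psym : symmetric_set P) (Pgen : generates P) (Gam : amenable R G)
    (p : G -> R) (p_l1 : summable [set: G] (fun x => (p x)%:E))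
    (p01 : forall x : G, 0 <= p x <= 1) (psym : forall x : G, p x = p (x^-1)%g)
    (mu : probability (config G) R) (mu_perc : percolation_measure p mu)
    (Q : nat -> {fset G}) (Qfolner : folner R Q) (Qtemp : tempered R Q)
    (Qincr : strictly_increasing Q) (Qtile : forall n : nat, monotile (Q n)) :
  exists N : R -> R,
    cvg_BR (fun n E => \sum_(S \in subgraphs_on (Q n))
                         nu p S * ((Ftilde_count S E)%:R / #|` Q n|%:R)) N
    /\ {ae mu, forall w : config G,
         cvg_BR (fun j E => (F_count w (Q j) E)%:R / #|` Q j|%:R) N}.
Proof.
have Q0 := Qfolner.1.
have p0 x : 0 <= p x by have /andP[] := p01 x.
pose A n (E : R) := \sum_(S \in subgraphs_on (Q n))
  nu p S * ((Ftilde_count S E)%:R / #|` Q n|%:R) : R.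
pose f (w : config G) j (E : R) := (F_count w (Q j) E)%:R / #|` Q j|%:R : R.
have est e : 0 < e -> \forall M \near \oo, {ae mu, forall w,
    \forall j \near \oo, forall E, `|f w j E - A M E| <= e}.
  move=> e0; have e10 : 0 < e / 10 by rewrite divr_gt0.
  apply: filterS (folner_boundary_mass p0 p_l1 Qfolner e10) => M mass.
  have [T tQT] := monotile_tiling (Q0 M) (Qtile M).
  have := ae_count_estimate Pgen p01 psym mu_perc Qfolner Qincr tQT e10 mass.
  by apply: filterS => w; apply: filterS => j jE E; have := jE E; rewrite /f /A; lra.
have [N [AN fN]] := uniform_limit_of_approximants est.
exists N; split.
  apply: cvg_BR_uniform AN => n; rewrite /A.
  have -> : (fun E : R => \sum_(S \in subgraphs_on (Q n))
      nu p S * ((Ftilde_count S E)%:R / #|` Q n|%:R) : R)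
    = (fun E => \sum_(S <- fset_set (subgraphs_on (Q n)))
      nu p S * (#|` Q n|%:R^-1 * (Ftilde_count S E)%:R)).
    apply/funext => E; rewrite fsbig_finite; last exact: subgraphs_on_finite.
    by apply: eq_bigr => S _; rewrite (mulrC (_%:R)).
  apply: BR_sum => S; do 2 apply: BR_scale.
  by apply: BR_eigen_count; exact: laplacian_sym.
apply: filterS fN => w fN; apply: cvg_BR_uniform fN => j.
have -> : f w j = (fun E => #|` Q j|%:R^-1 * (F_count w (Q j) E)%:R).
  by apply/funext => E; rewrite /f mulrC.
by apply: BR_scale; apply: BR_eigen_count; exact: laplacian_restr_sym.
Qed.
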